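(* Let $(X,\mu)$ and $(Y,\nu)$ be standard measure spaces, $H_1=L^2(X,\mu)$, $H_2=L^2(Y,\nu)$, and $\mathcal K=\mathcal K(H_1,H_2)$ the space of compact operators. If $E\subseteq X\times Y$ is a set of finite width then $\mathfrak M_{\max}(E)\cap\mathcal K$ coincides with the norm closure of the linear subspace of $\mathfrak M_{\max}(E)$ generated by the rank one operators in $\mathfrak M_{\max}(E)$.
   Context: Standard measure space: a ($\sigma$-finite) regular Borel measure with respect to some complete (separable) metrisable topology. $E\subseteq X\times Y$ is a set of finite width if there are $n\in\mathbb N$ and measurable functions $f_i:X\to\mathbb R$, $g_i:Y\to\mathbb R$, $i=1,\dots,n$, with $E=\{(x,y):f_i(x)\le g_i(y),\ i=1,\dots,n\}$. A set is marginally null if contained in $(X_0\times Y)\cup(X\times Y_0)$ with $\mu(X_0)=\nu(Y_0)=0$. $\mathfrak M_{\max}(E)$ is the space of all operators $T\in\mathcal B(H_1,H_2)$ supported on $E$, i.e. such that $P(\beta)TP(\alpha)=0$ whenever $\alpha\subseteq X$, $\beta\subseteq Y$ are measurable and $(\alpha\times\beta)\cap E$ is marginally null, where $P(\cdot)$ denotes multiplication by the characteristic function. *)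

(* Defs.v *)
From HB Require Import structures.
From mathcomp Require Import all_boot all_order all_algebra.
From mathcomp Require Import complex.
From mathcomp Require Import all_classical all_reals all_analysis.
From mathcomp Require Import measurable_realfun.

Set Implicit Arguments.
Unset Strict Implicit.
Unset Printing Implicit Defensive.

Import Order.TTheory GRing.Theory Num.Theory.
Import numFieldNormedType.Exports.

Local Open Scope classical_set_scope.
Local Open Scope complex_scope.
Local Open Scope ring_scope.

(* The carrier of a standard measure space: quantifying over complete separable
   metric spaces amounts to quantifying over completely metrisable separable
   topologies together with a choice of metric. *)
#[short(type="completeMetricType")]
HB.structure Definition CompleteMetric (R : numDomainType) :=
  {T of Metric R T & Complete T}.

Definition borel (T : ptopologicalType) := g_sigma_algebraType (@open T).
HB.instance Definition _ (T : ptopologicalType) := Measurable.on (borel T).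

Definition separable (T : topologicalType) :=
  exists2 D : set T, countable D & dense D.

Section StandardMeasure.
Context (R : realType) (X : completeMetricType R).

(* Outer regularity by open sets and inner regularity by compact sets, for
   every Borel set. *)
Definition regular_measure (mu : {measure set (borel X) -> \bar R}) :=
  forall A : set (borel X), measurable A ->
    mu A = ereal_inf [set mu U | U in [set U : set X | open U /\ A `<=` U]] /\
    mu A = ereal_sup [set mu K | K in [set K : set X | compact K /\ K `<=` A]].

Definition standard_measure (mu : {measure set (borel X) -> \bar R}) :=
  [/\ separable X, sigma_finite setT mu & regular_measure mu].

End StandardMeasure.

Section SquareIntegrable.
Context d (T : measurableType d) (R : realType).
Variable mu : {measure set T -> \bar R}.

Definition sq_integrable (f : T -> R[i]) : Prop :=
  [/\ measurable_fun setT (@complex.Re R \o f),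
      measurable_fun setT (@complex.Im R \o f) &
      finite_norm mu 2%:E (@Normc.normc R \o f)].

Definition L2fun_pred : {pred T -> R[i]} := fun f => `[< sq_integrable f >].

Local Notation N f := ('N[mu]_2%:E [EFin \o f])%E.

Let sq_ext (g h : T -> R) : (forall x, 0 <= g x <= h x) ->
  measurable_fun setT g -> measurable_fun setT h -> (N g <= N h)%E.
Proof.
move=> gh mg mh; rewrite unlock /Lnorm.
have mp (k : T -> R) : measurable_fun setT k ->
    measurable_fun setT (EFin \o (fun x => `|k x| `^ 2)).
  move=> mk; apply/measurable_EFinP.
  apply: (@measurableT_comp _ _ _ _ _ _ (fun x : R => x `^ 2)%R) => //.
  exact: measurableT_comp.
have i0 (k : T -> R) : (0 <= \int[mu]_x (EFin \o (fun x => `|k x| `^ 2)%R) x)%E.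
  by apply: integral_ge0 => x _ /=; rewrite lee_fin powR_ge0.
apply: gt0_ler_poweR; rewrite ?invr_ge0// ?in_itv/= ?leey ?andbT; [exact: i0|exact: i0|].
apply: (ge0_le_integral mu measurableT _ (mp _ mg) (mp _ mh)) => [x _|].
  by rewrite /= lee_fin powR_ge0.
move=> x _ /=; rewrite lee_fin.
have /andP[g0 ghx] := gh x.
by rewrite ge0_ler_powR ?nnegrE// !ger0_norm// (le_trans g0).
Qed.

Lemma measurable_normc (f : T -> R[i]) :
  measurable_fun setT (@complex.Re R \o f) ->
  measurable_fun setT (@complex.Im R \o f) ->
  measurable_fun setT (@Normc.normc R \o f).
Proof.
move=> mr mi.
rewrite (_ : _ \o f = Num.sqrt \o
  (fun x => complex.Re (f x) ^+ 2 + complex.Im (f x) ^+ 2)); last first.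
  by apply/funext => x /=; case: (f x).
apply: measurableT_comp.
  by apply: continuous_measurable_fun; exact: sqrt_continuous.
by apply: measurable_funD; exact: measurable_funX.
Qed.

Lemma sq_integrable0 : sq_integrable 0.
Proof.
split; [exact: measurable_cst|exact: measurable_cst|].
rewrite /finite_norm (_ : _ \o _ = cst 0%E).
  by rewrite Lnorm0.
by apply/funext => x; congr EFin; exact: Normc.normc0.
Qed.

Let ReD (x y : R[i]) : complex.Re (x + y) = complex.Re x + complex.Re y.
Proof. by case: x y => [? ?] []. Qed.
Let ImD (x y : R[i]) : complex.Im (x + y) = complex.Im x + complex.Im y.
Proof. by case: x y => [? ?] []. Qed.

Let NormcD (f g : T -> R[i]) : sq_integrable f -> sq_integrable g ->
  (N (@Normc.normc R \o (f + g)%R) <=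
   N (@Normc.normc R \o f) + N (@Normc.normc R \o g))%E.
Proof.
move=> [fr fi _] [gr gi _].
apply: (le_trans _ (eminkowski _ _ _ _)); [|exact: measurable_normc..|by rewrite lee_fin ler1n].
apply: sq_ext.
- move=> x /=; rewrite -[(f + g) x]/(f x + g x).
  rewrite le_normcD andbT; case: (f x + g x) => ? ?; exact: sqrtr_ge0.
- apply: measurable_normc.
  + rewrite (_ : _ \o _ = (@complex.Re R \o f) \+ (@complex.Re R \o g)).
      exact: measurable_funD.
    by apply/funext => x /=; rewrite -ReD.
  + rewrite (_ : _ \o _ = (@complex.Im R \o f) \+ (@complex.Im R \o g)).
      exact: measurable_funD.
    by apply/funext => x /=; rewrite -ImD.
- by apply: measurable_funD; exact: measurable_normc.
Qed.

Lemma sq_integrableD (f g : T -> R[i]) :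
  sq_integrable f -> sq_integrable g -> sq_integrable (f + g).
Proof.
move=> sf sg; have fg := NormcD sf sg; move: sf sg => [fr fi fn] [gr gi gn].
split.
- rewrite (_ : _ \o _ = (@complex.Re R \o f) \+ (@complex.Re R \o g)).
    exact: measurable_funD.
  by apply/funext => x /=; rewrite -ReD.
- rewrite (_ : _ \o _ = (@complex.Im R \o f) \+ (@complex.Im R \o g)).
    exact: measurable_funD.
  by apply/funext => x /=; rewrite -ImD.
- by rewrite /finite_norm (le_lt_trans fg)// lte_add_pinfty.
Qed.

Let NormcZ (a : R[i]) (f : T -> R[i]) : sq_integrable f ->
  N (@Normc.normc R \o (a *: f)) = ((Normc.normc a)%:E * N (@Normc.normc R \o f))%E.
Proof.
move=> [fr fi fn]; have mn := measurable_normc fr fi.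
have a0 : 0 <= Normc.normc a by case: (a) => ? ?; exact: sqrtr_ge0.
have nf : (@Normc.normc R \o f) \in Lfun mu 2%:E.
  by rewrite inE; apply/andP; split; rewrite inE.
have p1 : (1 <= 2%:E :> \bar R)%E by rewrite lee_fin ler1n.
have := @LnormZ _ _ _ mu _ p1 (Lfun_Sub p1 nf) (Normc.normc a).
rewrite (ger0_norm a0) => <-; apply: eq_Lnorm => x /=.
by congr EFin; exact: Normc.normcM.
Qed.

Lemma sq_integrableZ (a : R[i]) (f : T -> R[i]) :
  sq_integrable f -> sq_integrable (a *: f).
Proof.
move=> sf; have nZ := NormcZ a sf; move: sf => [fr fi fn].
split.
- rewrite (_ : _ \o _ = (fun x => complex.Re a * complex.Re (f x)
                                 - complex.Im a * complex.Im (f x))).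
    apply: measurable_funB; exact: measurable_funM.
  by apply/funext => x /=; rewrite -[(a *: f) x]/(a * f x); case: a (f x) {nZ} => [? ?] [].
- rewrite (_ : _ \o _ = (fun x => complex.Re a * complex.Im (f x)
                                 + complex.Im a * complex.Re (f x))).
    apply: measurable_funD; exact: measurable_funM.
  by apply/funext => x /=; rewrite -[(a *: f) x]/(a * f x); case: a (f x) {nZ} => [? ?] [].
- rewrite /finite_norm nZ lte_mul_pinfty// lee_fin.
  by case: (a) => ? ?; exact: sqrtr_ge0.
Qed.

Lemma L2fun_submod_closed : submod_closed L2fun_pred.
Proof.
split; first by apply/asboolP; exact: sq_integrable0.
move=> a f g /asboolP sf /asboolP sg; apply/asboolP.
by apply: sq_integrableD => //; exact: sq_integrableZ.
Qed.
HB.instance Definition _ :=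
  GRing.isSubmodClosed.Build R[i] (T -> R[i]) L2fun_pred L2fun_submod_closed.

Record L2fun := MkL2fun {
  L2fun_val :> T -> R[i];
  L2fun_valP : L2fun_val \in L2fun_pred }.
HB.instance Definition _ := [isSub for L2fun_val].
HB.instance Definition _ := [Choice of L2fun by <:].
HB.instance Definition _ := [SubChoice_isSubLmodule of L2fun by <:].

Lemma L2fun_sq_integrable (f : L2fun) : sq_integrable f.
Proof. exact/asboolP/L2fun_valP. Qed.

Definition aeq0 : {pred L2fun} := fun f => `[< {ae mu, forall x, f x = 0} >].

Lemma aeq0_zmod_closed : zmod_closed aeq0.
Proof.
split; first by apply/asboolP; exact: aeW.
move=> f g /asboolP f0 /asboolP g0; apply/asboolP.
apply: filterS2 f0 g0 => x f0 g0.
by rewrite -[(f - g) x]/(f x - g x) f0 g0 subrr.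
Qed.
HB.instance Definition _ := GRing.isZmodClosed.Build L2fun aeq0 aeq0_zmod_closed.

Definition L2 : Type := {ideal_quot aeq0}.
HB.instance Definition _ := GRing.Zmodule.on L2.
HB.instance Definition _ := EqQuotient.on L2.

Local Open Scope quotient_scope.

Lemma L2_eqP (f g : L2fun) :
  \pi_L2 f = \pi_L2 g <-> {ae mu, forall x, f x = g x}.
Proof.
have -> : (\pi_L2 f = \pi_L2 g) <-> f - g \in aeq0.
  by rewrite Quotient.idealrBE; split=> /eqP.
split=> [/asboolP|] fg.
  by apply: filterS fg => x /eqP; rewrite subr_eq0 => /eqP.
apply/asboolP; apply: filterS fg => x fg.
by rewrite -[(f - g) x]/(f x - g x) fg subrr.
Qed.

Lemma L2_reprP (f : L2fun) : {ae mu, forall x, repr (\pi_L2 f) x = f x}.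
Proof. by apply/L2_eqP; rewrite reprK. Qed.

Definition L2_scale (a : R[i]) (u : L2) : L2 := \pi_L2 (a *: repr u).

Lemma L2_scaleE a (f : L2fun) : L2_scale a (\pi_L2 f) = \pi_L2 (a *: f).
Proof.
apply/L2_eqP; apply: filterS (L2_reprP f) => x fx.
exact: (congr1 (fun z => a * z) fx).
Qed.

Lemma L2_addE (f g : L2fun) : \pi_L2 f + \pi_L2 g = \pi_L2 (f + g).
Proof. by rewrite Quotient.pi_add. Qed.

Lemma L2_ind (P : L2 -> Prop) : (forall f : L2fun, P (\pi_L2 f)) -> forall u, P u.
Proof. by move=> h u; rewrite -[u]reprK. Qed.

Let L2_scalerA a b u : L2_scale a (L2_scale b u) = L2_scale (a * b) u.
Proof. by elim/L2_ind: u => f; rewrite !L2_scaleE scalerA. Qed.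
Let L2_scale1 u : L2_scale 1 u = u.
Proof. by elim/L2_ind: u => f; rewrite !L2_scaleE scale1r. Qed.
Let L2_scaleDr a u v : L2_scale a (u + v) = L2_scale a u + L2_scale a v.
Proof.
by elim/L2_ind: u => f; elim/L2_ind: v => g; rewrite L2_addE !L2_scaleE L2_addE scalerDr.
Qed.
Let L2_scaleDl u a b : L2_scale (a + b) u = L2_scale a u + L2_scale b u.
Proof. by elim/L2_ind: u => f; rewrite !L2_scaleE L2_addE scalerDl. Qed.

HB.instance Definition _ := GRing.Zmodule_isLmodule.Build R[i] L2
  L2_scalerA L2_scale1 L2_scaleDr L2_scaleDl.

(* [Lmodule_isNormed] wants a norm with values in the scalar field [R[i]]. *)
Definition L2_norm (u : L2) : R[i] :=
  (fine (N (@Normc.normc R \o (repr u : T -> R[i]))))%:C.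

Lemma L2_normE (f : L2fun) :
  L2_norm (\pi_L2 f) = (fine (N (@Normc.normc R \o (f : T -> R[i]))))%:C.
Proof.
congr (fine _)%:C; rewrite unlock /Lnorm; congr poweR.
have mp (g : L2fun) :
    measurable_fun setT (EFin \o (fun x => `|Normc.normc (g x)| `^ 2)).
  have [gr gi _] := L2fun_sq_integrable g.
  apply/measurable_EFinP.
  apply: (@measurableT_comp _ _ _ _ _ _ (fun x : R => x `^ 2)%R) => //.
  by apply: measurableT_comp => //; exact: measurable_normc.
apply: (ge0_ae_eq_integral measurableT (mp _) (mp f)).
- by move=> x _ /=; rewrite lee_fin powR_ge0.
- by move=> x _ /=; rewrite lee_fin powR_ge0.
by apply: filterS (L2_reprP f) => x fx _; rewrite /= fx.
Qed.

Let N_fin (f : L2fun) : N (@Normc.normc R \o (f : T -> R[i])) \is a fin_num.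
Proof.
have [_ _ fn] := L2fun_sq_integrable f.
by rewrite ge0_fin_numE// Lnorm_ge0.
Qed.

Let L2_normD u v : L2_norm (u + v) <= L2_norm u + L2_norm v.
Proof.
elim/L2_ind: u => f; elim/L2_ind: v => g.
rewrite L2_addE !L2_normE -rmorphD lecR -lee_fin [leRHS]EFinD !fineK//.
exact: (NormcD (L2fun_sq_integrable f) (L2fun_sq_integrable g)).
Qed.

Let L2_normZ a u : L2_norm (a *: u) = `|a| * L2_norm u.
Proof.
elim/L2_ind: u => f.
rewrite -[a *: _]/(L2_scale a _) L2_scaleE !L2_normE.
have -> : `|a| = (Normc.normc a)%:C by [].
rewrite -rmorphM; congr (_%:C); apply: EFin_inj; rewrite EFinM !fineK//.
exact: (NormcZ a (L2fun_sq_integrable f)).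
Qed.

Let L2_norm0_eq0 u : L2_norm u = 0 -> u = 0.
Proof.
elim/L2_ind: u => f; rewrite L2_normE => -[f0].
have -> : 0 = \pi_L2 0 :> L2 by apply: (addrI (\pi_L2 0)); rewrite L2_addE !addr0.
apply/L2_eqP.
have : N (@Normc.normc R \o (f : T -> R[i])) = 0%E by rewrite -[LHS]fineK// f0.
have [fr fi _] := L2fun_sq_integrable f.
have mf : measurable_fun setT (EFin \o (@Normc.normc R \o (f : T -> R[i]))).
  by apply/measurable_EFinP; exact: measurable_normc.
have p0 : (0 < 2%:E :> \bar R)%E by rewrite lte_fin.
move=> /(Lnorm_eq0_eq0 mf p0).
apply: filterS => x /(_ I) /= [].
exact: Normc.eq0_normc.
Qed.

HB.instance Definition _ := Lmodule_isNormed.Build R[i] L2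
  L2_normD L2_normZ L2_norm0_eq0.

Lemma L2_norm_piE (f : L2fun) :
  `|\pi_L2 f| = (fine (N (@Normc.normc R \o (f : T -> R[i]))))%:C.
Proof. exact: L2_normE. Qed.

(* Multiplication by the indicator of [A]; [insubd] only takes its default
   value when [A] is not measurable, see [chi_mulP]. *)
Definition chi_mul (A : set T) (u : L2) : L2 :=
  \pi_L2 (insubd 0 (fun x => (\1_A x : R)%:C * repr u x)).

Let chi_sq_integrable (A : set T) (f : L2fun) : measurable A ->
  sq_integrable (fun x => (\1_A x : R)%:C * f x).
Proof.
move=> mA; have [fr fi fn] := L2fun_sq_integrable f.
have m1 : measurable_fun setT (\1_A : T -> R) by exact: measurable_indic.
have [gr gi] :
  measurable_fun setT (@complex.Re R \o (fun x => (\1_A x : R)%:C * f x)) /\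
  measurable_fun setT (@complex.Im R \o (fun x => (\1_A x : R)%:C * f x)).
  split.
    rewrite (_ : _ \o _ = \1_A \* (@complex.Re R \o f)).
      exact: measurable_funM.
    by apply/funext => x /=; case: (f x) => ? ?; rewrite /= mul0r subr0.
  rewrite (_ : _ \o _ = \1_A \* (@complex.Im R \o f)).
    exact: measurable_funM.
  by apply/funext => x /=; case: (f x) => ? ?; rewrite /= mul0r addr0.
split=> //; apply: le_lt_trans fn; apply: sq_ext.
- move=> x; rewrite /= Normc.normcM indicE.
  have n0 : 0 <= Normc.normc (f x) by case: (f x) => ? ?; exact: sqrtr_ge0.
  have -> : Normc.normc ((x \in A)%:R : R)%:C = (x \in A)%:R.
    by case: (x \in A); [exact: Normc.normc1|exact: Normc.normc0].
  by case: (x \in A); rewrite /= ?mul1r ?mul0r ?n0 lexx.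
- exact: measurable_normc.
- exact: measurable_normc.
Qed.

Lemma chi_mulP (A : set T) (u : L2) : measurable A ->
  {ae mu, forall x, repr (chi_mul A u) x = (\1_A x : R)%:C * repr u x}.
Proof.
move=> mA; have gA : (fun x => (\1_A x : R)%:C * repr u x) \in L2fun_pred.
  by apply/asboolP; exact: chi_sq_integrable.
apply: filterS (L2_reprP (insubd 0 (fun x => (\1_A x : R)%:C * repr u x))) => x ->.
exact: (congr1 (@^~ x) (insubdK 0 gA)).
Qed.

End SquareIntegrable.

Arguments L2 {d T R} mu.

Section BoundedOperators.
Context (R : realType) (V W : normedModType R[i]).

Definition bounded_linear (f : V -> W) : Prop :=
  linear f /\ exists M : R[i], forall x, `|f x| <= M * `|x|.

Definition bounded_op_pred : {pred V -> W} := fun f => `[< bounded_linear f >].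

Lemma bounded_op_submod_closed : submod_closed bounded_op_pred.
Proof.
split.
  apply/asboolP; split; first by move=> a x y; rewrite /= scaler0 addr0.
  by exists 0 => x; rewrite mul0r normr0.
move=> a f g /asboolP[lf [M fM]] /asboolP[lg [N gN]]; apply/asboolP; split.
  move=> b x y; rewrite -[LHS]/(a *: f (b *: x + y) + g (b *: x + y)).
  rewrite -[RHS]/(b *: (a *: f x + g x) + (a *: f y + g y)).
  rewrite lf lg !scalerDr !scalerA [b * a]mulrC -!addrA; congr (_ + _).
  by rewrite addrCA.
exists (`|a| * M + N) => x; rewrite -[(a *: f + g) x]/(a *: f x + g x).
rewrite (le_trans (ler_normD _ _))// normrZ mulrDl lerD// -mulrA.
by rewrite ler_wpM2l.
Qed.
HB.instance Definition _ :=
  GRing.isSubmodClosed.Build R[i] (V -> W) bounded_op_pred bounded_op_submod_closed.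

Record bounded_op := MkBoundedOp { bounded_op_val :> V -> W; bounded_op_valP : bounded_op_val \in bounded_op_pred }.
HB.instance Definition _ := [isSub for bounded_op_val].
HB.instance Definition _ := [Choice of bounded_op by <:].
HB.instance Definition _ := [SubChoice_isSubLmodule of bounded_op by <:].

Lemma bounded_op_linear (T : bounded_op) : linear T.
Proof. by have /asboolP[] := bounded_op_valP T. Qed.
HB.instance Definition _ (T : bounded_op) :=
  GRing.isLinear.Build R[i] V W *:%R T (bounded_op_linear T).

Definition opnorm (T : bounded_op) : R :=
  sup [set complex.Re `|T x| | x in [set x : V | `|x| <= 1]].

Let normE (U : normedModType R[i]) (x : U) : `|x| = (complex.Re `|x|)%:C.
Proof. by rewrite RRe_real// ger0_real. Qed.

Lemma opnorm_has_sup (T : bounded_op) :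
  has_sup [set complex.Re `|T x| | x in [set x : V | `|x| <= 1]].
Proof.
split; first by exists (complex.Re `|T 0|); exists 0 => //=; rewrite normr0.
have /asboolP[_ [M TM]] := bounded_op_valP T.
exists (complex.Re `|M|) => _ [x /= x1 <-].
have := TM x; rewrite -[M * _]ger0_norm ?(le_trans _ (TM x))// normrM normr_id => h.
by rewrite -lecR -!normE (le_trans h)// ler_piMr.
Qed.

Lemma opnorm_ub (T : bounded_op) (x : V) : `|T x| <= (opnorm T)%:C * `|x|.
Proof.
have [->|x0] := eqVneq x 0; first by rewrite linear0 !normr0 mulr0.
have nx : 0 < `|x| by rewrite normr_gt0.
have -> : T x = `|x| *: T (`|x|^-1 *: x).
  by rewrite linearZ scalerA divff ?scale1r// gt_eqF.
rewrite normrZ normr_id mulrC ler_wpM2r// [leLHS]normE lecR.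
apply: ub_le_sup; first exact: (opnorm_has_sup T).2.
exists (`|x|^-1 *: x) => //=.
by rewrite normrZ normrV ?unitfE ?gt_eqF// normr_id mulVf ?gt_eqF.
Qed.

Lemma opnorm_le (T : bounded_op) (M : R) :
  (forall x, `|x| <= 1 -> `|T x| <= M%:C) -> opnorm T <= M.
Proof.
move=> TM; apply: ge_sup; first exact: (opnorm_has_sup T).1.
by move=> _ [x /= x1 <-]; rewrite -lecR -normE TM.
Qed.

Lemma opnorm_ge0 (T : bounded_op) : 0 <= opnorm T.
Proof.
apply: le_trans (_ : complex.Re `|T 0| <= _); first by rewrite linear0 normr0.
apply: ub_le_sup; first exact: (opnorm_has_sup T).2.
by exists 0 => //=; rewrite normr0.
Qed.

Let opnormD (S T : bounded_op) : (opnorm (S + T))%:C <= (opnorm S)%:C + (opnorm T)%:C.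
Proof.
rewrite -rmorphD lecR; apply: opnorm_le => x x1.
rewrite rmorphD (le_trans (ler_normD _ _))// lerD//.
  by rewrite (le_trans (opnorm_ub S x))// ler_piMr// ler0c opnorm_ge0.
by rewrite (le_trans (opnorm_ub T x))// ler_piMr// ler0c opnorm_ge0.
Qed.

Let opnormZ_le a (T : bounded_op) : (opnorm (a *: T))%:C <= `|a| * (opnorm T)%:C.
Proof.
have aE : `|a| = (Normc.normc a)%:C by [].
rewrite aE -rmorphM lecR; apply: opnorm_le => x x1.
rewrite rmorphM /= -aE [leLHS](_ : _ = `|a| * `|T x|); last by rewrite -normrZ.
rewrite ler_wpM2l//.
by rewrite (le_trans (opnorm_ub T x))// ler_piMr// ler0c opnorm_ge0.
Qed.

Let opnormZ a (T : bounded_op) : (opnorm (a *: T))%:C = `|a| * (opnorm T)%:C.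
Proof.
apply/eqP; rewrite eq_le opnormZ_le /=.
have [->|a0] := eqVneq a 0; first by rewrite normr0 mul0r ler0c opnorm_ge0.
have := opnormZ_le a^-1 (a *: T); rewrite scalerA mulVf// scale1r.
by rewrite normfV ler_pdivlMl ?normr_gt0.
Qed.

Let opnorm0_eq0 (T : bounded_op) : (opnorm T)%:C = 0 -> T = 0.
Proof.
move=> T0; apply/val_inj/funext => x; apply/eqP; rewrite -normr_le0.
by rewrite (le_trans (opnorm_ub T x))// T0 mul0r.
Qed.

HB.instance Definition _ := Lmodule_isNormed.Build R[i] bounded_op
  opnormD opnormZ opnorm0_eq0.

Lemma bounded_op_normE (T : bounded_op) : `|T| = (opnorm T)%:C.
Proof. by []. Qed.

Definition compact_ops : set bounded_op :=
  [set T | precompact (T @` [set x | `|x| <= 1])].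

Definition rank_one_ops : set bounded_op :=
  [set T | exists2 y : W, y != 0 & range T = [set c *: y | c in [set: R[i]]]].

End BoundedOperators.

Arguments compact_ops {R} V W.
Arguments rank_one_ops {R} V W.

Definition lin_span (K : pzRingType) (V : lmodType K) (A : set V) : set V :=
  [set v | exists n (c : 'I_n -> K) (a : 'I_n -> V),
     (forall i, A (a i)) /\ v = \sum_(i < n) c i *: a i].

Section Support.
Context d1 d2 (X : measurableType d1) (Y : measurableType d2) (R : realType).

Definition finite_width (E : set (X * Y)) : Prop :=
  exists n (f : 'I_n -> {mfun X >-> R}) (g : 'I_n -> {mfun Y >-> R}),
    E = [set p | forall i, f i p.1 <= g i p.2].

Variables (mu : {measure set X -> \bar R}) (nu : {measure set Y -> \bar R}).

Definition marginally_null (E : set (X * Y)) : Prop :=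
  exists (X0 : set X) (Y0 : set Y),
    [/\ measurable X0, measurable Y0, mu X0 = 0%E, nu Y0 = 0%E &
        E `<=` (X0 `*` setT) `|` (setT `*` Y0)].

Definition Mmax (E : set (X * Y)) : set (bounded_op (L2 mu) (L2 nu)) :=
  [set T : bounded_op (L2 mu) (L2 nu) | forall (alpha : set X) (beta : set Y),
     measurable alpha -> measurable beta ->
     marginally_null ((alpha `*` beta) `&` E) ->
     chi_mul beta \o T \o chi_mul alpha = cst 0].

End Support.

Arguments finite_width {d1 d2 X Y} R E.
Arguments Mmax {d1 d2 X Y R} mu nu E.

(* Main.v *)
(* For the inclusion from left to right, induct on the number of inequalities
   f_i(x) <= g_i(y) defining E, the case n = 0 being the approximation of compact
   operators by finite rank ones. To handle one more inequality f(x) <= g(y) for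
   a compact T, cut the real line into finitely many ordered cells, each of which
   is a point or has P(g in cell) T small in norm: by compactness of T only
   finitely many vectors have to be made small, and one-sided punctured
   neighbourhoods of every point do that. The block P(g in C_k) T P(f in C_j)
   vanishes for j > k; for j < k, or for j = k when the cell is a point, its
   rectangle lies in {f <= g}, so the induction hypothesis followed by compression
   to the rectangle approximates it; the remaining diagonal blocks add up to a
   block diagonal operator, whose norm is the largest of theirs. Conversely both
   M_max(E) and the compact operators form closed subspaces, the latter by
   completeness of L2. *)

Require Import Defs.
From HB Require Import structures.
From mathcomp Require Import all_boot all_order all_algebra.
From mathcomp Require Import complex.
From mathcomp Require Import all_classical all_reals all_analysis.
From mathcomp Require Import measurable_realfun ring lra zify.

Set Implicit Arguments.
Unset Strict Implicit.
Unset Printing Implicit Defensive.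

Import Order.TTheory GRing.Theory Num.Theory.
Import numFieldNormedType.Exports.

Local Open Scope classical_set_scope.
Local Open Scope ring_scope.

(** * Normed spaces over R[i], spans and bounded operators *)

Local Notation "x %:C" := (real_complex _ x) : ring_scope.

(** * Real-valued norms, total boundedness and precompactness *)

Section RealNorm.
Context (R : realType) (V : normedModType R[i]).
Implicit Types (x y : V) (A B : set V).

(** The norm of a space over [R[i]] is a complex number; its real part carries the same information
    and lives in a totally ordered field. *)
Definition rnorm x : R := complex.Re `|x|.

Lemma rnormE x : `|x| = (rnorm x)%:C.
Proof. by rewrite /rnorm RRe_real// ger0_real. Qed.

Lemma rnorm_ge0 x : 0 <= rnorm x.
Proof. by rewrite -ler0c -rnormE. Qed.

Lemma rnorm0 : rnorm 0 = 0.
Proof. by rewrite /rnorm normr0. Qed.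

Lemma rnorm_eq0 x : rnorm x = 0 -> x = 0.
Proof. by move=> x0; apply/eqP; rewrite -normr_eq0 rnormE x0. Qed.

Lemma rnormB x y : rnorm (x - y) = rnorm (y - x).
Proof. by rewrite /rnorm distrC. Qed.

Lemma ler_rnormD x y : rnorm (x + y) <= rnorm x + rnorm y.
Proof. by rewrite -lecR rmorphD /= -!rnormE ler_normD. Qed.

Lemma ler_rdistD y x z : rnorm (x - z) <= rnorm (x - y) + rnorm (y - z).
Proof. by rewrite (le_trans _ (ler_rnormD _ _))// addrA subrK. Qed.

Lemma rnormZ (c : R[i]) x : rnorm (c *: x) = Normc.normc c * rnorm x.
Proof.
apply: complexI; rewrite rmorphM /= -!rnormE normrZ; congr (_ * _).
Qed.

Lemma ballE x y (e : R) : ball x e%:C y = (rnorm (x - y) < e) :> Prop.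
Proof. by rewrite -ball_normE /ball_/= rnormE ltcR. Qed.

Lemma nbhs_rnorm x (P : set V) :
  nbhs x P <-> exists2 e : R, 0 < e & forall y, rnorm (x - y) < e -> P y.
Proof.
split=> [/nbhs_ballP[e /= e0 eP]|[e e0 eP]].
  have eE : e = (complex.Re e)%:C by rewrite RRe_real// gtr0_real.
  exists (complex.Re e); first by rewrite -ltcR -eE.
  by move=> y xy; apply: eP; rewrite eE ballE.
apply/nbhs_ballP; exists e%:C; first by rewrite /= ltcR.
by move=> y; rewrite ballE; exact: eP.
Qed.

Lemma closure_rnorm A x :
  closure A x <-> forall e : R, 0 < e -> exists2 y, A y & rnorm (x - y) < e.
Proof.
split=> [clA e e0|h B /nbhs_rnorm[e e0 eB]].
  have [|y [Ay]] := clA [set y | rnorm (x - y) < e]; last by exists y.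
  by apply/nbhs_rnorm; exists e.
by have [y Ay xy] := h _ e0; exists y; split=> //; exact: eB.
Qed.

(** The centres need not lie in [A], so sums, images and perturbations of nets are again nets
    without any adjustment. *)
Definition totally_bounded A := forall e : R, 0 < e ->
  exists s : seq V, forall x, A x -> exists2 y, y \in s & rnorm (x - y) < e.

Lemma precompact_totally_bounded A : precompact A -> totally_bounded A.
Proof.
rewrite precompactE compact_cover => cA e e0.
have [|x Ax|D _ AD] := cA V (closure A) (fun x => ball x e%:C).
- by move=> x _; apply: ball_open; rewrite ltcR.
- by exists x => //; rewrite ballE subrr rnorm0.
exists (finmap.enum_fset D) => x Ax.
have [y yD] := AD x (subset_closure Ax).
by rewrite ballE rnormB => xy; exists y.
Qed.

(** Completeness restricted to sequences with geometric increments; in [L2] this rate leaves room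
    for the weights [4 ^+ n] of the Riesz-Fischer argument. *)
Definition fast_cauchy_cvg := forall u : nat -> V,
  (forall n, rnorm (u n.+1 - u n) <= 4^-1 ^+ n) ->
  exists l, forall e : R, 0 < e -> \forall n \near \oo, rnorm (l - u n) < e.

(** Peel off one piece at a time: an ultrafilter contains [P a] or its complement, and in the second
    case the remaining pieces still contain a member of [F]. *)
Lemma ultra_seq_cover (T : eqType) (F : set_system V) (s : seq T)
    (P : T -> set V) : UltraFilter F ->
  F [set x | exists2 y : T, y \in s & P y x] -> exists y : T, F (P y).
Proof.
move=> UF; elim: s => [|a s IHs].
  by case/filter_ex => x [].
move=> Fs; have [Fa|Fa] := in_ultra_setVsetC (P a) UF; first by exists a.
apply: IHs; apply: filterS2 Fs Fa => x [y].
rewrite inE => /orP[/eqP ->//|ys] Py _.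
by exists y.
Qed.

(** An ultrafilter on the closure contains arbitrarily small balls; the centres of a sequence of
    them converge, and their limit is a limit of the ultrafilter. *)
Lemma totally_bounded_precompact A :
  fast_cauchy_cvg -> totally_bounded A -> precompact A.
Proof.
move=> cV tA; rewrite precompactE compact_ultra => F UF FA.
have tcA e : 0 < e -> exists y, F [set x | rnorm (x - y) < e].
  move=> e0; have [|s sA] := tA (e / 2); first by rewrite divr_gt0.
  apply: (ultra_seq_cover (s := s)); apply: filterS FA => x clAx.
  have [z Az xz] := (closure_rnorm A x).1 clAx (e / 2) ltac:(by rewrite divr_gt0).
  have [y ys zy] := sA z Az; exists y => //=.
  by rewrite (le_lt_trans (ler_rdistD z _ _))// (splitr e) ltrD.
(* Consecutive balls belong to [F], hence meet; halving the radii brings their centres within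
   [4^-1 ^+ n] of each other. *)
have /choice[u uF] : forall n, exists y, F [set x | rnorm (x - y) < 4^-1 ^+ n / 2].
  by move=> n; apply: tcA; rewrite divr_gt0// exprn_gt0// invr_gt0.
have e4 n : (4^-1 ^+ n.+1 : R) <= 4^-1 ^+ n.
  by apply: ler_wiXn2l => //; rewrite ?invr_ge0// invf_le1// ler1n.
have [l lu] : exists l, forall e : R, 0 < e -> \forall n \near \oo, rnorm (l - u n) < e.
  apply: cV => n; have [x /= [x1 x2]] := filter_ex (filterI (uF n.+1) (uF n)).
  rewrite (le_trans (ler_rdistD x _ _))// rnormB.
  have := e4 n; lra.
have cvF : F --> l.
  move=> P /nbhs_rnorm[e e0 eP].
  have e20 : 0 < e / 2 by rewrite divr_gt0.
  have : \forall n \near \oo, (4^-1 : R) ^+ n < e / 2.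
    have : (fun n => (4^-1 : R) ^+ n) @ \oo --> (0 : R).
      by apply: cvg_expr; rewrite ger0_norm ?invr_ge0// invf_lt1// ltr1n.
    move/cvgrPdist_lt => /(_ _ e20); apply: filterS => n.
    by rewrite sub0r normrN ger0_norm// exprn_ge0// invr_ge0.
  move=> en; have [n [ln {}en]] := filter_ex (filterI (lu _ e20) en).
  apply: filterS (uF n) => x /= xn; apply: eP.
  rewrite (le_lt_trans (ler_rdistD (u n) _ _))// [rnorm (u n - x)]rnormB.
  have : 0 <= (4^-1 : R) ^+ n by rewrite exprn_ge0// invr_ge0.
  lra.
exists l; split=> //; apply/closure_rnorm => e e0.
have e20 : 0 < e / 2 by rewrite divr_gt0.
have Fl : F [set x | rnorm (l - x) < e / 2].
  by apply: cvF; apply/nbhs_rnorm; exists (e / 2).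
have [x [/= /closure_rnorm clx lx]] := filter_ex (filterI FA Fl).
have [y Ay xy] := clx _ e20; exists y => //.
by rewrite (le_lt_trans (ler_rdistD x _ _))// (splitr e) ltrD.
Qed.

End RealNorm.

(** * Linear spans and their closures *)

Section Span.
Context (K : pzRingType) (V : lmodType K).
Implicit Types A : set V.

Lemma lin_span0 A : lin_span A 0.
Proof.
exists 0%N, (fun=> 0), (fun=> 0); split; first by case.
by rewrite big_ord0.
Qed.

Lemma lin_spanD A x y : lin_span A x -> lin_span A y -> lin_span A (x + y).
Proof.
move=> [n [c [a [Aa ->]]]] [m [d [b [Ab ->]]]].
exists (n + m)%N.
exists (fun i : 'I_(n + m) => match fintype.split i with inl j => c j | inr j => d j end).
exists (fun i : 'I_(n + m) => match fintype.split i with inl j => a j | inr j => b j end).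
split; first by move=> i; case: fintype.split.
rewrite big_split_ord; congr (_ + _); apply: eq_bigr => i _.
  by rewrite (unsplitK (inl _ i)).
by rewrite (unsplitK (inr _ i)).
Qed.

Lemma lin_spanZ A c x : lin_span A x -> lin_span A (c *: x).
Proof.
move=> [n [d [a [Aa ->]]]]; exists n, (fun i => c * d i), a; split=> //.
by rewrite scaler_sumr; apply: eq_bigr => i _; rewrite scalerA.
Qed.

Lemma subset_lin_span A : A `<=` lin_span A.
Proof.
move=> x Ax; exists 1%N, (fun=> 1), (fun=> x); split=> //.
by rewrite big_ord1 scale1r.
Qed.

Lemma lin_span_sum A I (s : seq I) (P : pred I) (F : I -> V) :
  (forall i, P i -> lin_span A (F i)) -> lin_span A (\sum_(i <- s | P i) F i).
Proof.
by move=> AF; apply: big_ind => //; [exact: lin_span0|exact: lin_spanD].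
Qed.

Lemma lin_span_subset A (B : set V) : B 0 -> (forall x y, B x -> B y -> B (x + y)) ->
  (forall c x, B x -> B (c *: x)) -> A `<=` B -> lin_span A `<=` B.
Proof.
move=> B0 BD BZ AB _ [n [c [a [Aa ->]]]].
by apply: big_ind => // i _; apply: BZ; exact: AB.
Qed.

End Span.

Section ClosureSpan.
Context (R : realType) (V : normedModType R[i]).
Implicit Types A : set V.

Lemma closure_lin_span0 A : closure (lin_span A) 0.
Proof. exact/subset_closure/lin_span0. Qed.

Lemma closure_lin_spanD A x y : closure (lin_span A) x ->
  closure (lin_span A) y -> closure (lin_span A) (x + y).
Proof.
move=> /closure_rnorm Ax /closure_rnorm Ay; apply/closure_rnorm => e e0.
have e20 : 0 < e / 2 by rewrite divr_gt0.
have [a Aa xa] := Ax _ e20; have [b Ab yb] := Ay _ e20.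
exists (a + b); first exact: lin_spanD.
rewrite opprD addrACA (le_lt_trans (ler_rnormD _ _))// (splitr e) ltrD//.
Qed.

Lemma closure_lin_span_sum A I (s : seq I) (P : pred I) (F : I -> V) :
  (forall i, P i -> closure (lin_span A) (F i)) ->
  closure (lin_span A) (\sum_(i <- s | P i) F i).
Proof.
move=> AF; apply: big_ind => //; first exact: closure_lin_span0.
exact: closure_lin_spanD.
Qed.

End ClosureSpan.

(** * Composition, rank one operators and totally bounded operators *)

Section BoundedOps.
Context (R : realType).
Implicit Types (U V W : normedModType R[i]).

Lemma bounded_linear_rnorm V W (f : V -> W) (M : R) : linear f ->
  (forall x, rnorm (f x) <= M * rnorm x) -> f \in @bounded_op_pred R V W.
Proof.
move=> lf fM; apply/asboolP; split=> //; exists M%:C => x.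
by rewrite !rnormE -rmorphM lecR.
Qed.

Definition mk_op V W (f : V -> W) (M : R) (lf : linear f)
    (fM : forall x, rnorm (f x) <= M * rnorm x) : bounded_op V W :=
  MkBoundedOp (bounded_linear_rnorm lf fM).

Lemma rnorm_op_ub V W (T : bounded_op V W) x : rnorm (T x) <= rnorm T * rnorm x.
Proof. by have := opnorm_ub T x; rewrite !rnormE -rmorphM lecR. Qed.

Lemma rnorm_op_le V W (T : bounded_op V W) (M : R) :
  (forall x, rnorm x <= 1 -> rnorm (T x) <= M) -> rnorm T <= M.
Proof.
move=> TM; apply: opnorm_le => x; rewrite !rnormE !lecR; exact: TM.
Qed.

Lemma comp_op_linear U V W (S : bounded_op V W) (T : bounded_op U V) :
  linear (S \o T).
Proof. by move=> a x y /=; rewrite !linearP. Qed.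

Lemma comp_op_bound U V W (S : bounded_op V W) (T : bounded_op U V) x :
  rnorm ((S \o T) x) <= rnorm S * rnorm T * rnorm x.
Proof.
rewrite -mulrA (le_trans (rnorm_op_ub _ _))//.
by rewrite ler_wpM2l ?rnorm_ge0// rnorm_op_ub.
Qed.

Definition comp_op U V W (S : bounded_op V W) (T : bounded_op U V) :
  bounded_op U W := mk_op (comp_op_linear S T) (comp_op_bound S T).

Lemma rnorm_comp_op U V W (S : bounded_op V W) (T : bounded_op U V) :
  rnorm (comp_op S T) <= rnorm S * rnorm T.
Proof.
apply: rnorm_op_le => x x1; rewrite (le_trans (comp_op_bound _ _ _))//.
by rewrite ler_piMr// mulr_ge0// rnorm_ge0.
Qed.

Lemma op_ext V W (S T : bounded_op V W) : (forall x, S x = T x) -> S = T.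
Proof. by move=> ST; apply/val_inj/funext. Qed.

Lemma addopE V W (S T : bounded_op V W) x : (S + T) x = S x + T x.
Proof. by []. Qed.

Lemma subopE V W (S T : bounded_op V W) x : (S - T) x = S x - T x.
Proof. by []. Qed.

Lemma scaleopE V W c (T : bounded_op V W) x : (c *: T) x = c *: T x.
Proof. by []. Qed.

Lemma sumopE V W I (s : seq I) (P : pred I) (F : I -> bounded_op V W) x :
  (\sum_(i <- s | P i) F i) x = \sum_(i <- s | P i) F i x.
Proof. by elim/big_rec2: _ => // i y T _ <-. Qed.

(** Unlike rank one, this survives compression, which may turn a rank one operator into 0. *)
Definition rank_le1 V W (T : bounded_op V W) :=
  exists y, forall x, exists c, T x = c *: y.

Lemma rank_le1_rank_one V W (T : bounded_op V W) :
  rank_le1 T -> T = 0 \/ rank_one_ops V W T.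
Proof.
move=> [y Ty]; have [T0|/existsNP[x0 Tx0]] := pselect (forall x, T x = 0).
  by left; apply: op_ext.
right; have [c0 Tc0] := Ty x0.
have c00 : c0 != 0 by apply: contra_notN Tx0 => /eqP c0E; rewrite Tc0 c0E scale0r.
exists y.
  by apply: contra_notN Tx0 => /eqP y0; rewrite Tc0 y0 scaler0.
apply/seteqP; split=> [_ [x _ <-]|_ [c _ <-]].
  by have [c ->] := Ty x; exists c.
exists ((c / c0) *: x0) => //.
by rewrite linearZ /= Tc0 scalerA divfK.
Qed.

Lemma rank_one_le1 V W (T : bounded_op V W) : rank_one_ops V W T -> rank_le1 T.
Proof.
move=> [y _ rT]; exists y => x.
have : range T (T x) by exists x.
by rewrite rT => -[c _ <-]; exists c.
Qed.

(** Stands in for compactness, since its stability under limits, sums and composition is elementary;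
    it is compactness once the target is complete. *)
Definition tb_op V W : set (bounded_op V W) :=
  [set T | totally_bounded (T @` [set x | `|x| <= 1])].

Lemma tb_opP V W (T : bounded_op V W) : tb_op T <->
  forall e : R, 0 < e -> exists s : seq W,
    forall x, rnorm x <= 1 -> exists2 y, y \in s & rnorm (T x - y) < e.
Proof.
split=> h e /h[s sT]; exists s; last first.
  by move=> _ [x /= x1 <-]; apply: sT; rewrite -lecR -rnormE.
by move=> x x1; apply: sT; exists x; rewrite //= rnormE lecR.
Qed.

Lemma tb_op_closed V W : closure (@tb_op V W) `<=` @tb_op V W.
Proof.
move=> T /closure_rnorm clT; apply/tb_opP => e e0.
have e20 : 0 < e / 2 by rewrite divr_gt0.
have [S /tb_opP/(_ _ e20)[s sS] TS] := clT _ e20; exists s => x x1.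
have [y ys Sy] := sS x x1; exists y => //.
rewrite (le_lt_trans (ler_rdistD (S x) _ _))// (splitr e) ltrD//.
rewrite -subopE (le_lt_trans (rnorm_op_ub _ _))// (le_lt_trans _ TS)//.
by rewrite ler_piMr// rnorm_ge0.
Qed.

Lemma tb_op0 V W : tb_op (0 : bounded_op V W).
Proof.
apply/tb_opP => e e0; exists [:: 0] => x _; exists 0; first by rewrite inE.
by rewrite subr0 [_ x](_ : _ = 0)// rnorm0.
Qed.

Lemma tb_opD V W (S T : bounded_op V W) : tb_op S -> tb_op T -> tb_op (S + T).
Proof.
move=> /tb_opP tS /tb_opP tT; apply/tb_opP => e e0.
have e20 : 0 < e / 2 by rewrite divr_gt0.
have [s sS] := tS _ e20; have [t tT'] := tT _ e20.
exists [seq y + z | y <- s, z <- t] => x x1.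
have [y ys Sy] := sS x x1; have [z zt Tz] := tT' x x1.
exists (y + z); first by apply/allpairsP; exists (y, z).
by rewrite addopE opprD addrACA (le_lt_trans (ler_rnormD _ _))// (splitr e) ltrD.
Qed.

Lemma tb_op_comp U V W (S : bounded_op V W) (T : bounded_op U V) :
  tb_op T -> tb_op (comp_op S T).
Proof.
move=> /tb_opP tT; apply/tb_opP => e e0.
(* The added 1 keeps the divisor positive when [S] is 0. *)
have S0 : 0 < rnorm S + 1 by rewrite ltr_wpDl ?rnorm_ge0.
have [|s sT] := tT (e / (rnorm S + 1)); first by rewrite divr_gt0.
exists [seq S y | y <- s] => x x1; have [y ys Ty] := sT x x1.
exists (S y); first exact: map_f.
rewrite (_ : comp_op S T x - S y = S (T x - y)); last by rewrite linearB.
rewrite (le_lt_trans (rnorm_op_ub _ _))//.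
move: Ty; rewrite ltr_pdivlMr// => Ty; rewrite (le_lt_trans _ Ty)// mulrC.
by rewrite ler_wpM2l ?rnorm_ge0// lerDl.
Qed.

Lemma tb_op_precomp U V W (S : bounded_op V W) (T : bounded_op U V) :
  rnorm T <= 1 -> tb_op S -> tb_op (comp_op S T).
Proof.
move=> T1 /tb_opP tS; apply/tb_opP => e /tS[s sS].
exists s => x x1; apply: sS.
by rewrite (le_trans (rnorm_op_ub _ _))// mulr_ile1// rnorm_ge0.
Qed.

Lemma tb_opZ V W c (T : bounded_op V W) : tb_op T -> tb_op (c *: T).
Proof.
move=> /tb_opP tT; apply/tb_opP => e e0.
have c0 : 0 < rnorm (c : R[i]^o) + 1 by rewrite ltr_wpDl ?rnorm_ge0.
have [|s sT] := tT (e / (rnorm (c : R[i]^o) + 1)); first by rewrite divr_gt0.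
exists [seq c *: y | y <- s] => x x1; have [y ys Ty] := sT x x1.
exists (c *: y); first exact: map_f.
rewrite scaleopE -scalerBr rnormZ.
move: Ty; rewrite ltr_pdivlMr// => Ty; rewrite (le_lt_trans _ Ty)// mulrC.
by rewrite ler_wpM2l ?rnorm_ge0// lerDl.
Qed.

Lemma real_grid (M e : R) : 0 < e ->
  exists s : seq R, forall a, `|a| <= M -> exists2 b, b \in s & `|a - b| < e.
Proof.
(* A grid of mesh [e] starting at [- M]; [b] will be the last grid point not above [a]. *)
move=> e0; exists [seq i%:R * e - M | i <- iota 0 (Num.truncn ((M + M) / e)).+1].
move=> a; rewrite ler_norml => /andP[Ma aM].
have aM0 : 0 <= (a + M) / e by apply: divr_ge0; [lra|exact: ltW].
set i := Num.truncn ((a + M) / e).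
exists (i%:R * e - M).
  apply/mapP; exists i => //; rewrite mem_iota/= add0n ltnS.
  by apply: le_truncn; rewrite ler_wpM2r ?invr_ge0 ?(ltW e0)//; lra.
have := truncn_itv aM0; rewrite -/i ler_pdivlMr// ltr_pdivrMr//.
rewrite -addn1 natrD mulrDl mul1r => /andP[h1 h2].
by rewrite ger0_norm; lra.
Qed.

Lemma normc_le_abs (a b : R) : Normc.normc (a +i* b)%C <= `|a| + `|b|.
Proof.
rewrite /Normc.normc -(ger0_norm (addr_ge0 (normr_ge0 a) (normr_ge0 b))).
rewrite -sqrtr_sqr ler_wsqrtr// sqrrD !real_normK ?num_real//.
by rewrite addrAC lerDl mulrn_wge0// mulr_ge0.
Qed.

Lemma abs_Re_normc (c : R[i]) : `|complex.Re c| <= Normc.normc c.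
Proof.
by case: c => a b; rewrite /Normc.normc/= -sqrtr_sqr ler_wsqrtr// lerDl sqr_ge0.
Qed.

Lemma abs_Im_normc (c : R[i]) : `|complex.Im c| <= Normc.normc c.
Proof.
by case: c => a b; rewrite /Normc.normc/= -sqrtr_sqr ler_wsqrtr// lerDr sqr_ge0.
Qed.

(** The unit ball goes to multiples of [z] with coefficients of modulus at most [rnorm T / rnorm z],
    and a square grid of coefficients gives a net. *)
Lemma rank_one_tb V W (T : bounded_op V W) : rank_one_ops V W T -> tb_op T.
Proof.
move=> [z z0 rT]; apply/tb_opP => e e0.
have nz : 0 < rnorm z.
  rewrite lt_neqAle rnorm_ge0 andbT; apply: contra_neqN z0 => /eqP z0.
  exact/rnorm_eq0.
(* The errors of the real and imaginary parts add up, so the mesh is half of [e / rnorm z]. *)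
have [|s sM] := real_grid (rnorm T / rnorm z) (_ : 0 < e / (rnorm z + rnorm z)).
  by rewrite divr_gt0// addr_gt0.
exists [seq (a +i* b)%C *: z | a <- s, b <- s] => x x1.
have : range T (T x) by exists x.
rewrite rT => -[c _ Tx].
have cM : Normc.normc c <= rnorm T / rnorm z.
  rewrite ler_pdivlMr// -rnormZ Tx (le_trans (rnorm_op_ub _ _))//.
  by rewrite ler_piMr// rnorm_ge0.
have [a sa ca] := sM _ (le_trans (abs_Re_normc c) cM).
have [b sb cb] := sM _ (le_trans (abs_Im_normc c) cM).
exists ((a +i* b)%C *: z); first by apply/allpairsP; exists (a, b).
rewrite -Tx -scalerBl rnormZ.
have -> : c - (a +i* b)%C = ((complex.Re c - a) +i* (complex.Im c - b))%C.
  by case: c {Tx cM ca cb}.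
rewrite -ltr_pdivlMr// (le_lt_trans (normc_le_abs _ _))//.
rewrite (lt_le_trans (ltrD ca cb))// -mulr2n -[rnorm z + _]mulr2n.
by rewrite -[e / _ *+ 2]mulr_natr -[rnorm z *+ 2]mulr_natr invfM mulrA divfK// pnatr_eq0.
Qed.

End BoundedOps.

(** * Integral formulas in L2 and multiplication by indicators *)

Section L2Integrals.
Context d (T : measurableType d) (R : realType).
Variable mu : {measure set T -> \bar R}.
Local Open Scope quotient_scope.
Implicit Types (u v w : L2 mu) (f g : L2fun mu) (A B : set T).

(** For chaining: each use pushes one more almost everywhere identity into the goal, until [aeW]
    leaves a pointwise computation. *)
Lemma ae_app (P Q : T -> Prop) : {ae mu, forall x, P x} ->
  {ae mu, forall x, P x -> Q x} -> {ae mu, forall x, Q x}.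
Proof. by move=> aeP aePQ; apply: filterS2 aeP aePQ => x Px; exact. Qed.

(** The squared modulus as a polynomial in the two parts, free of square roots, so that
    measurability and ring identities are immediate. *)
Definition normsq (z : R[i]) : R := complex.Re z ^+ 2 + complex.Im z ^+ 2.

Lemma normsq_ge0 z : 0 <= normsq z.
Proof. by rewrite addr_ge0// sqr_ge0. Qed.

Lemma normsqE z : normsq z = Normc.normc z ^+ 2.
Proof.
by case: z => a b; rewrite /Normc.normc sqr_sqrtr// addr_ge0// sqr_ge0.
Qed.

Lemma normsqM (z w : R[i]) : normsq (z * w) = normsq z * normsq w.
Proof. by rewrite !normsqE Normc.normcM exprMn. Qed.

Lemma measurable_normsq (f : T -> R[i]) :
  measurable_fun setT (@complex.Re R \o f) ->
  measurable_fun setT (@complex.Im R \o f) ->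
  measurable_fun setT (fun x => (normsq (f x))%:E).
Proof.
move=> fr fi; apply/measurable_EFinP.
by apply: measurable_funD; exact: measurable_funX.
Qed.

Lemma measurable_normsq_L2fun f :
  measurable_fun setT (fun x => (normsq (f x))%:E).
Proof.
by have [fr fi _] := L2fun_sq_integrable f; exact: measurable_normsq.
Qed.

Lemma rnorm_pi f :
  (rnorm (\pi_(L2 mu) f) ^+ 2)%:E = (\int[mu]_x (normsq (f x))%:E)%E.
Proof.
have [fr fi fn] := L2fun_sq_integrable f.
rewrite /rnorm L2_norm_piE /= -powR_mulrn ?fine_ge0 ?Lnorm_ge0//.
rewrite -poweR_EFin fineK ?ge0_fin_numE ?Lnorm_ge0//.
rewrite powR_Lnorm ?pnatr_eq0//; apply: eq_integral => x _ /=.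
by rewrite powR_mulrn// real_normK ?num_real// -normsqE.
Qed.

Lemma rnorm_repr u : (rnorm u ^+ 2)%:E = (\int[mu]_x (normsq (repr u x))%:E)%E.
Proof. by rewrite -{1}[u]reprK rnorm_pi. Qed.

Lemma L2_ext u v : {ae mu, forall x, repr u x = repr v x} -> u = v.
Proof. by move=> /L2_eqP; rewrite !reprK. Qed.

Lemma rnorm_ae u (F : T -> \bar R) : measurable_fun setT F ->
  (forall x, 0 <= F x)%E -> {ae mu, forall x, (normsq (repr u x))%:E = F x} ->
  (rnorm u ^+ 2)%:E = (\int[mu]_x F x)%E.
Proof.
move=> mF F0 uF; rewrite rnorm_repr; apply: ge0_ae_eq_integral => //.
- exact: measurable_normsq_L2fun.
- by move=> x _; rewrite lee_fin normsq_ge0.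
- by apply: filterS uF => x ->.
Qed.

Lemma reprD u v : {ae mu, forall x, repr (u + v) x = repr u x + repr v x}.
Proof.
have /L2_eqP// : \pi_(L2 mu) (repr (u + v)) = \pi_(L2 mu) (repr u + repr v).
by rewrite -L2_addE !reprK.
Qed.

Lemma reprZ c u : {ae mu, forall x, repr (c *: u) x = c * repr u x}.
Proof.
have /L2_eqP// : \pi_(L2 mu) (repr (c *: u)) = \pi_(L2 mu) (c *: repr u).
by rewrite -L2_scaleE !reprK.
Qed.

Lemma repr0 : {ae mu, forall x, repr (0 : L2 mu) x = 0}.
Proof.
have := reprZ 0 (0 : L2 mu); rewrite scale0r.
by apply: filterS => x ->; rewrite mul0r.
Qed.

Lemma repr_sum I (s : seq I) (P : pred I) (F : I -> L2 mu) :
  {ae mu, forall x, repr (\sum_(i <- s | P i) F i) x = \sum_(i <- s | P i) repr (F i) x}.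
Proof.
elim: s => [|i s IHs].
  by rewrite big_nil; apply: filterS repr0 => x ->; rewrite big_nil.
rewrite big_cons; case: ifPn => Pi; last first.
  by apply: filterS IHs => x ->; rewrite big_cons (negbTE Pi).
apply: filterS2 IHs (reprD (F i) (\sum_(j <- s | P j) F j)) => x IH ->.
by rewrite IH big_cons Pi.
Qed.

Lemma normsq_indic A (x : T) (z : R[i]) :
  normsq ((\1_A x : R)%:C * z) = \1_A x * normsq z.
Proof.
rewrite normsqM indicE; congr (_ * _).
by case: (x \in A); rewrite /normsq/= ?expr1n ?expr0n/= addr0.
Qed.

Lemma measurable_indic_normsq A u : measurable A ->
  measurable_fun setT (fun x => (\1_A x * normsq (repr u x))%:E).
Proof.
move=> mA; apply/measurable_EFinP; apply: measurable_funM => //.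
exact/measurable_EFinP/measurable_normsq_L2fun.
Qed.

Lemma indic_normsq_ge0 A u x : (0 <= (\1_A x * normsq (repr u x))%:E)%E.
Proof. by rewrite lee_fin mulr_ge0 ?normsq_ge0// indicE ler0n. Qed.

Lemma rnorm_chi A u : measurable A ->
  (rnorm (chi_mul A u) ^+ 2)%:E = (\int[mu]_x (\1_A x * normsq (repr u x))%:E)%E.
Proof.
move=> mA; apply: rnorm_ae; first exact: measurable_indic_normsq.
  exact: indic_normsq_ge0.
by apply: filterS (chi_mulP u mA) => x ->; rewrite normsq_indic.
Qed.

Lemma chi_mul_linear A : measurable A -> linear (@chi_mul _ _ _ mu A).
Proof.
move=> mA a u v; apply: L2_ext.
apply: (ae_app (chi_mulP (a *: u + v) mA)); apply: (ae_app (reprD (a *: u) v)).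
apply: (ae_app (chi_mulP u mA)); apply: (ae_app (chi_mulP v mA)).
apply: (ae_app (reprD (a *: chi_mul A u) (chi_mul A v))).
apply: (ae_app (reprZ a (chi_mul A u))); apply: (ae_app (reprZ a u)).
apply: aeW => x e1 e2 -> e3 e4 e5 ->; by rewrite e5 e1 e2 e3 e4 mulrDr mulrCA.
Qed.

Lemma rnorm_chi_le A u : measurable A -> rnorm (chi_mul A u) <= 1 * rnorm u.
Proof.
move=> mA; rewrite mul1r -(@ler_pXn2r _ 2) ?nnegrE ?rnorm_ge0// -lee_fin.
rewrite rnorm_chi// rnorm_repr; apply: ge0_le_integral => //.
- by move=> x _; exact: indic_normsq_ge0.
- exact: measurable_indic_normsq.
- exact: measurable_normsq_L2fun.
by move=> x _; rewrite lee_fin ler_piMl ?normsq_ge0.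
Qed.

Definition chi_op A (mA : measurable A) : bounded_op (L2 mu) (L2 mu) :=
  mk_op (chi_mul_linear mA) (fun u => rnorm_chi_le u mA).

Lemma rnorm_chi_op A (mA : measurable A) : rnorm (chi_op mA) <= 1.
Proof.
by apply: rnorm_op_le => x x1; rewrite (le_trans (rnorm_chi_le _ mA))// mul1r.
Qed.

Lemma chi_mulI A B u : measurable A -> measurable B ->
  chi_mul A (chi_mul B u) = chi_mul (A `&` B) u.
Proof.
move=> mA mB; apply: L2_ext; have mAB := measurableI _ _ mA mB.
apply: (ae_app (chi_mulP (chi_mul B u) mA)); apply: (ae_app (chi_mulP u mB)).
apply: (ae_app (chi_mulP u mAB)); apply: aeW => x -> e ->; rewrite e mulrA -rmorphM/= !indicE in_setI.
by rewrite -mulnb natrM.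
Qed.

Lemma chi_mul_null A u : measurable A -> mu A = 0%E -> chi_mul A u = 0.
Proof.
move=> mA A0; apply: L2_ext.
have nA : mu.-negligible A by apply/negligibleP.
have aeA : {ae mu, forall x, ~ A x} by apply: negligibleS nA => x /= /contrapT.
apply: (ae_app aeA); apply: (ae_app (chi_mulP u mA)); apply: (ae_app repr0).
by apply: aeW => x -> -> Ax; rewrite indicE memNset// mul0r.
Qed.

(** Dominated convergence: the indicators of [B n] tend to 0 pointwise and [normsq (repr u x)]
    dominates. *)
Lemma chi_mul_cvg0 (B : nat -> set T) u (e : R) : (forall n, measurable (B n)) ->
  (forall x, \forall n \near \oo, ~ B n x) -> 0 < e ->
  \forall n \near \oo, rnorm (chi_mul (B n) u) < e.
Proof.
move=> mB B0 e0.
have iu : mu.-integrable setT (fun x => (normsq (repr u x))%:E).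
  apply/integrableP; split; first exact: measurable_normsq_L2fun.
  under eq_integral do rewrite gee0_abs ?lee_fin ?normsq_ge0//.
  by rewrite -rnorm_repr ltry.
have [||_ _] := dominated_convergence measurableT
  (fun n => measurable_indic_normsq u (mB n)) (measurable_cst (0%:E : \bar R))
  _ iu _.
- apply: aeW => x _; apply: cvg_near_cst; apply: filterS (B0 x) => n Bx.
  by rewrite indicE memNset// mul0r.
- apply: aeW => x n _; rewrite gee0_abs ?indic_normsq_ge0// lee_fin.
  by rewrite ler_piMl ?normsq_ge0.
rewrite integral0 => cv.
have /fine_cvgP[_] : (rnorm (chi_mul (B n) u) ^+ 2)%:E @[n --> \oo] --> 0%:E.
  by apply: cvg_trans cv; apply: near_eq_cvg; near=> n; rewrite rnorm_chi.
move=> /cvgrPdist_lt/(_ (e ^+ 2)); rewrite exprn_gt0// => /(_ isT).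
apply: filterS => n /=; rewrite sub0r normrN ger0_norm ?sqr_ge0//.
by rewrite ltr_pXn2r ?nnegrE ?rnorm_ge0 ?ltW.
Unshelve. all: by end_near. Qed.

Section Partition.
Variables (N : nat) (q : T -> 'I_N).
Hypothesis mq : forall k, measurable (q @^-1` [set k]).

(** Encoding a partition by the fibres of a map to ['I_N] builds in disjointness and covering: at
    each point exactly one indicator is 1. *)
Lemma sum_indic_partition (x : T) (F : R) :
  \sum_(k < N) \1_(q @^-1` [set k]) x * F = F.
Proof.
rewrite (bigD1 (q x))//= big1 => [|k kx].
  by rewrite indicE mem_set// mul1r addr0.
by rewrite indicE memNset ?mul0r//= => qx; rewrite qx eqxx in kx.
Qed.

Lemma chi_partition u : u = \sum_(k < N) chi_mul (q @^-1` [set k]) u.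
Proof.
apply: L2_ext.
have h : {ae mu, forall x, forall k, repr (chi_mul (q @^-1` [set k]) u) x =
    (\1_(q @^-1` [set k]) x : R)%:C * repr u x}.
  by apply: filter_forall => k; exact: chi_mulP.
apply: filterS2 h (repr_sum (index_enum 'I_N) xpredT
  (fun k => chi_mul (q @^-1` [set k]) u)) => x h ->.
rewrite (eq_bigr _ (fun k _ => h k)) -mulr_suml -rmorph_sum/=.
have := sum_indic_partition x 1.
by rewrite -mulr_suml mulr1 => ->; rewrite mul1r.
Qed.

(** Pythagoras for the pieces of [u], obtained by integrating the pointwise identity rather than
    from an inner product. *)
Lemma rnorm_partition u :
  rnorm u ^+ 2 = \sum_(k < N) rnorm (chi_mul (q @^-1` [set k]) u) ^+ 2.
Proof.
apply: EFin_inj; rewrite rnorm_repr -sumEFin.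
under [RHS]eq_bigr do rewrite rnorm_chi//.
rewrite -ge0_integral_sum//.
- by apply: eq_integral => x _; rewrite sumEFin sum_indic_partition.
- by move=> k; exact: measurable_indic_normsq.
- by move=> k x _; exact: indic_normsq_ge0.
Qed.

End Partition.
End L2Integrals.

Arguments chi_op {d T R mu A} mA.

(** * Inner product and finite rank approximation *)

Section InnerProduct.
Context d (T : measurableType d) (R : realType).
Variable mu : {measure set T -> \bar R}.
Implicit Types (u v w : L2 mu).

(* Real ([b = true]) and imaginary ([b = false]) parts of [z * conj w]. *)
Definition mulJ (b : bool) (z w : R[i]) : R :=
  if b then complex.Re z * complex.Re w + complex.Im z * complex.Im w
  else complex.Im z * complex.Re w - complex.Re z * complex.Im w.

(** Squares of sums and differences are nonnegative. The bound makes the integrand of the inner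
    product integrable by comparison. *)
Lemma abs_mulJ b (z w : R[i]) : `|mulJ b z w| <= normsq z + normsq w.
Proof.
case: b z w => -[p q] [r s]; rewrite /mulJ /normsq/= ler_norml.
  have := sqr_ge0 (p + r); have := sqr_ge0 (p - r).
  have := sqr_ge0 (q + s); have := sqr_ge0 (q - s).
  have := sqr_ge0 p; have := sqr_ge0 q; have := sqr_ge0 r; have := sqr_ge0 s.
  by rewrite !sqrrD !sqrrN !mulrN => *; apply/andP; split; lra.
have := sqr_ge0 (q + r); have := sqr_ge0 (q - r).
have := sqr_ge0 (p + s); have := sqr_ge0 (p - s).
have := sqr_ge0 p; have := sqr_ge0 q; have := sqr_ge0 r; have := sqr_ge0 s.
by rewrite !sqrrD !sqrrN !mulrN => *; apply/andP; split; lra.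
Qed.

Let intg (f : T -> R) := mu.-integrable setT (EFin \o f).

Lemma intgD f g : intg f -> intg g -> intg (fun x => f x + g x).
Proof. by move=> If Ig; exact: (integrableD measurableT If Ig). Qed.

Lemma intgZ (c : R) f : intg f -> intg (fun x => c * f x).
Proof. by move=> If; exact: (integrableZl measurableT c If). Qed.

Lemma intg_normsq u : intg (fun x => normsq (repr u x)).
Proof.
apply/integrableP; split; first exact: measurable_normsq_L2fun.
under eq_integral do rewrite gee0_abs ?lee_fin ?normsq_ge0//.
by rewrite -rnorm_repr ltry.
Qed.

Lemma intg_mulJ b u v : intg (fun x => mulJ b (repr u x) (repr v x)).
Proof.
apply: (@le_integrable _ _ _ mu _ measurableT _
  (EFin \o (fun x => normsq (repr u x) + normsq (repr v x)))).
- apply/measurable_EFinP.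
  have [ur ui _] := L2fun_sq_integrable (repr u).
  have [vr vi _] := L2fun_sq_integrable (repr v).
  case: b; rewrite /mulJ; [apply: measurable_funD|apply: measurable_funB];
    exact: measurable_funM.
- move=> x _; rewrite [leLHS]abse_EFin [leRHS]abse_EFin lee_fin.
  rewrite [leRHS]ger0_norm; first exact: abs_mulJ.
  by apply: addr_ge0; exact: normsq_ge0.
by apply: intgD; exact: intg_normsq.
Qed.

Lemma Rintegral_ae (f g : T -> R) : intg f -> intg g ->
  {ae mu, forall x, f x = g x} -> (\int[mu]_x f x = \int[mu]_x g x)%R.
Proof.
move=> /integrableP[mf _] /integrableP[mg _] fg; congr fine.
by apply: ae_eq_integral => //; apply: filterS fg => x ->.
Qed.

Lemma rnorm_Rintegral u : rnorm u ^+ 2 = (\int[mu]_x normsq (repr u x))%R.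
Proof. by rewrite /Rintegral -rnorm_repr. Qed.

(** The inner product, linear in [u], assembled from two real integrals. *)
Definition inner u v : R[i] :=
  ((\int[mu]_x mulJ true (repr u x) (repr v x))%R +i*
   (\int[mu]_x mulJ false (repr u x) (repr v x))%R)%C.

Lemma Rintegral_comb (p q : R) f g h : intg f -> intg g -> intg h ->
  (\int[mu]_x (p * f x + q * g x + h x) =
   p * (\int[mu]_x f x) + q * (\int[mu]_x g x) + \int[mu]_x h x)%R.
Proof.
move=> If Ig Ih; have Ipf := intgZ p If; have Iqg := intgZ q Ig.
rewrite (RintegralD measurableT (intgD Ipf Iqg) Ih).
by rewrite (RintegralD measurableT Ipf Iqg) !RintegralZl.
Qed.

Lemma inner_linear a u w v : inner (a *: u + w) v = a * inner u v + inner w v.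
Proof.
have aeD : {ae mu, forall x, repr (a *: u + w) x = a * repr u x + repr w x}.
  apply: (ae_app (reprD (a *: u) w)); apply: (ae_app (reprZ a u)).
  by apply: aeW => x -> ->.
have I b z := intg_mulJ b z v.
have comb b p q : {ae mu, forall x, mulJ b (a * repr u x + repr w x) (repr v x) =
    p * mulJ true (repr u x) (repr v x) + q * mulJ false (repr u x) (repr v x)
    + mulJ b (repr w x) (repr v x)} ->
    (\int[mu]_x mulJ b (repr (a *: u + w) x) (repr v x) =
      p * (\int[mu]_x mulJ true (repr u x) (repr v x))
      + q * (\int[mu]_x mulJ false (repr u x) (repr v x))
      + \int[mu]_x mulJ b (repr w x) (repr v x))%R.
  move=> h; rewrite -Rintegral_comb//; apply: Rintegral_ae => //.
    by apply: intgD => //; apply: intgD; exact: intgZ.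
  by apply: (ae_app aeD); apply: filterS h => x + ->.
rewrite /inner (comb true (complex.Re a) (- complex.Im a)); last first.
  apply: aeW => x; rewrite /mulJ.
  by case: (repr u x) (repr v x) (repr w x) (a) => p q [r s] [y z] [b c]/=; ring.
rewrite (comb false (complex.Im a) (complex.Re a)); last first.
  apply: aeW => x; rewrite /mulJ.
  by case: (repr u x) (repr v x) (repr w x) (a) => p q [r s] [y z] [b c]/=; ring.
case: (a) => p q; apply/eqP; rewrite eq_complex/=.
by apply/andP; split; apply/eqP; ring.
Qed.

Lemma inner_self u : inner u u = (rnorm u ^+ 2)%:C.
Proof.
rewrite /inner rnorm_Rintegral; congr Complex.
rewrite [X in Rintegral _ _ X](_ : _ = fun=> 0); last first.
  by apply/funext => x; rewrite /mulJ mulrC subrr.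
by rewrite /Rintegral integral0.
Qed.

(** The middle term is twice the real part of the conjugate of [c] times [inner u v]. For the
    coefficient used in [proj_off_line] the last two terms add up to something nonpositive, whence a
    contraction. *)
Lemma rnorm_sub_sqr u v c : rnorm (u - c *: v) ^+ 2 = rnorm u ^+ 2
  - 2 * (complex.Re c * complex.Re (inner u v) + complex.Im c * complex.Im (inner u v))
  + normsq c * rnorm v ^+ 2.
Proof.
have aeD : {ae mu, forall x, repr (u - c *: v) x = repr u x - c * repr v x}.
  rewrite -scaleNr; apply: (ae_app (reprD u (- c *: v))).
  by apply: (ae_app (reprZ (- c) v)); apply: aeW => x -> ->; rewrite mulNr.
have I b := intg_mulJ b u v; have J w := intg_normsq w.
have K : intg (fun x => normsq c * normsq (repr v x) + normsq (repr u x)).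
  by apply: intgD => //; exact: intgZ.
rewrite !rnorm_Rintegral.
rewrite (_ : (\int[mu]_x normsq (repr (u - c *: v) x))%R =
  (\int[mu]_x ((- 2 * complex.Re c) * mulJ true (repr u x) (repr v x)
     + (- 2 * complex.Im c) * mulJ false (repr u x) (repr v x)
     + (normsq c * normsq (repr v x) + normsq (repr u x))))%R); last first.
  apply: Rintegral_ae => //.
    by apply: intgD => //; apply: intgD; exact: intgZ.
  apply: filterS aeD => x ->; case: (repr u x) (repr v x) (c) => p q [r s] [y z].
  by rewrite /normsq /mulJ/=; ring.
rewrite Rintegral_comb// (RintegralD measurableT (intgZ _ (J v)) (J u)).
rewrite (RintegralZl (normsq c) measurableT (J v)).
rewrite -[(\int[mu]_x mulJ true _ _)%R]/(complex.Re (inner u v)).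
rewrite -[(\int[mu]_x mulJ false _ _)%R]/(complex.Im (inner u v)).
by ring.
Qed.

(* The map [u |-> u - (<u, e> / <e, e>) e] is the projection off the line of [e]. *)
Lemma proj_off_line (e : L2 mu) : exists N : bounded_op (L2 mu) (L2 mu),
  [/\ forall u, rnorm (N u) <= rnorm u, N e = 0 &
      exists phi : L2 mu -> R[i], forall u, u - N u = phi u *: e].
Proof.
pose n := rnorm e ^+ 2; pose phi u := (n^-1)%:C * inner u e.
have philin a u v : phi (a *: u + v) = a * phi u + phi v.
  by rewrite /phi inner_linear mulrDr mulrCA.
pose N u := u - phi u *: e.
have Nlin : linear N.
  move=> a u v; rewrite /N philin scalerDl scalerBr scalerA opprD.
  by rewrite addrACA.
have N1 u : rnorm (N u) <= 1 * rnorm u.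
  rewrite mul1r -(@ler_pXn2r _ 2) ?nnegrE ?rnorm_ge0//.
  rewrite rnorm_sub_sqr -/n /phi.
  have -> : normsq ((n^-1)%:C * inner u e) * n = n^-1 * normsq (inner u e).
    rewrite normsqM mulrAC [normsq _%:C](_ : _ = n^-1 ^+ 2); last first.
      by rewrite /normsq/= expr0n addr0.
    (* For [e = 0] the convention that 0 has inverse 0 makes [phi] vanish, and [N] is the
       identity. *)
    have [->|n0] := eqVneq n 0; first by rewrite invr0 mulr0 !mul0r.
    by rewrite expr2 mulfVK.
  have -> : complex.Re ((n^-1)%:C * inner u e) = n^-1 * complex.Re (inner u e).
    by rewrite /= mul0r subr0.
  have -> : complex.Im ((n^-1)%:C * inner u e) = n^-1 * complex.Im (inner u e).
    by rewrite /= mul0r addr0.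
  rewrite -!mulrA -mulrDr -!expr2 -/(normsq _) mulrA.
  have : 0 <= n^-1 * normsq (inner u e).
    by rewrite mulr_ge0 ?normsq_ge0// invr_ge0 sqr_ge0.
  lra.
exists (mk_op Nlin N1); split => [u||].
- by rewrite -[leRHS]mul1r; exact: N1.
- rewrite /= /N /phi inner_self -/n -rmorphM/=.
  have [e0|n0] := eqVneq n 0; last by rewrite mulVf// scale1r subrr.
  rewrite (_ : e = 0) ?scaler0 ?subrr//; apply: rnorm_eq0.
  by apply/eqP; rewrite -sqrf_eq0 -/n e0.
- by exists phi => u; rewrite /= /N opprB addrC subrK.
Qed.

End InnerProduct.

Lemma rank_one_span_rank_le1 (R : realType) (V W : normedModType R[i])
  (S : bounded_op V W) : rank_le1 S -> lin_span (rank_one_ops V W) S.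
Proof.
move=> /rank_le1_rank_one[->|]; first exact: lin_span0.
exact: subset_lin_span.
Qed.

(** Kill the vectors of [s] one at a time, as in Gram-Schmidt: the new factor annihilates [Q y],
    keeps what is already 0, and changes the operator by rank at most one. *)
Lemma proj_off_seq d (T : measurableType d) (R : realType)
    (mu : {measure set T -> \bar R}) (V : normedModType R[i])
    (S : bounded_op V (L2 mu)) (s : seq (L2 mu)) :
  exists Q : bounded_op (L2 mu) (L2 mu),
  [/\ forall u, rnorm (Q u) <= rnorm u, forall y, y \in s -> Q y = 0 &
      lin_span (rank_one_ops V (L2 mu)) (S - comp_op Q S)].
Proof.
elim: s => [|y s [Q [Q1 Qs QS]]].
  have id1 (u : L2 mu) : rnorm (id u) <= 1 * rnorm u by rewrite mul1r.
  have idl : linear (@id (L2 mu)) by [].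
  exists (mk_op idl id1); split=> //.
  by rewrite (_ : S - _ = 0); [exact: lin_span0|apply: op_ext => x; exact: subrr].
have [N [N1 Ny [phi Nphi]]] := proj_off_line (Q y).
exists (comp_op N Q); split=> [u|z|].
- exact: le_trans (N1 _) (Q1 _).
- rewrite inE => /orP[/eqP ->//|/Qs Qz].
  by rewrite /= Qz linear0.
- rewrite (_ : S - _ = (S - comp_op Q S) + (comp_op Q S - comp_op N (comp_op Q S))).
    apply: lin_spanD => //; apply: rank_one_span_rank_le1.
    by exists (Q y) => x; exists (phi (Q (S x))); exact: Nphi.
  by rewrite addrA subrK; congr (_ - _); exact: op_ext.
Qed.

(** If the contraction [Q] kills an [e / 2]-net of the image of the unit ball, then [Q S] has norm
    at most [e / 2], while [S - Q S] is a combination of rank one operators. *)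
Lemma tb_op_finite_rank_approx d (T : measurableType d) (R : realType)
    (mu : {measure set T -> \bar R}) (V : normedModType R[i])
    (S : bounded_op V (L2 mu)) :
  tb_op S -> closure (lin_span (rank_one_ops V (L2 mu))) S.
Proof.
move=> /tb_opP tS; apply/closure_rnorm => e e0.
have [|s sS] := tS (e / 2); first by rewrite divr_gt0.
have [Q [Q1 Qs QS]] := proj_off_seq S s.
exists (S - comp_op Q S) => //; rewrite opprB addrC subrK.
apply: (@le_lt_trans _ _ (e / 2)); last by rewrite ltr_pdivrMr// mulr_natr mulr2n ltrDl.
apply: rnorm_op_le => x x1; have [y ys Sy] := sS x x1.
rewrite /= -[Q _]subr0 -(Qs _ ys) -linearB (le_trans (Q1 _))//.
exact: ltW.
Qed.

(** * Completeness of L2 *)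

(** The radius [r n] is the sum of the bounds on all later increments, so the intervals of radius
    [r n] about [a n] are nested; the limit is the supremum of their left ends. *)
Lemma geometric_increments_limit (R : realType) (a : nat -> R) (K : R) : 0 <= K ->
  (forall n, `|a n.+1 - a n| <= 2^-1 ^+ n * K) ->
  exists l, forall n, `|l - a n| <= 2 * (2^-1 ^+ n * K).
Proof.
move=> K0 aK; pose r n : R := 2 * (2^-1 ^+ n * K).
have rS n : r n = 2^-1 ^+ n * K + r n.+1.
  by rewrite /r exprS; field.
have r0 n : 0 <= r n by rewrite !mulr_ge0// exprn_ge0// invr_ge0.
have loS n : a n - r n <= a n.+1 - r n.+1.
  by move: (aK n) (rS n); rewrite ler_norml => /andP[]; lra.
have hiS n : a n.+1 + r n.+1 <= a n + r n.
  by move: (aK n) (rS n); rewrite ler_norml => /andP[]; lra.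
have /nondecreasing_seqP lo : forall n, a n - r n <= a n.+1 - r n.+1 := loS.
have /nonincreasing_seqP hi : forall n, a n.+1 + r n.+1 <= a n + r n := hiS.
have lohi m n : a m - r m <= a n + r n.
  rewrite (le_trans (lo _ _ (leq_maxl m n)))//.
  rewrite (le_trans _ (hi _ _ (leq_maxr m n)))//.
  by rewrite lerD2l ge0_cp.
have hs : has_sup (range (fun n => a n - r n)).
  by split; [exists (a 0%N - r 0%N), 0%N|exists (a 0%N + r 0%N) => _ [n _ <-]].
exists (sup (range (fun n => a n - r n))) => k; rewrite -/(r k).
rewrite ler_distl; apply/andP; split.
  by apply: ub_le_sup; [exact: hs.2|exists k].
by apply: ge_sup; [exact: hs.1|move=> _ [m _ <-]].
Qed.

Section Completeness.
Context d (T : measurableType d) (R : realType).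
Variable mu : {measure set T -> \bar R}.

Lemma sq_integrable_normsq (f : T -> R[i]) :
  measurable_fun setT (@complex.Re R \o f) ->
  measurable_fun setT (@complex.Im R \o f) ->
  (\int[mu]_x (normsq (f x))%:E < +oo)%E -> sq_integrable mu f.
Proof.
move=> mr mi foo; split=> //; rewrite /finite_norm.
apply: (@lty_poweRy _ _ 2); first by rewrite pnatr_eq0.
rewrite powR_Lnorm ?pnatr_eq0//; apply: le_lt_trans foo.
rewrite le_eqVlt; apply/orP; left; apply/eqP; apply: eq_integral => x _ /=.
by rewrite powR_mulrn// real_normK ?num_real// -normsqE.
Qed.

Lemma normsqD_le (z w : R[i]) : normsq (z + w) <= 2 * normsq z + 2 * normsq w.
Proof.
case: z w => a b [c e]; rewrite /normsq/=.
have := sqr_ge0 (a - c); have := sqr_ge0 (b - e); rewrite !sqrrB !sqrrD.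
lra.
Qed.

(* Riesz-Fischer. With [|v_n|^2] integrating to at most [16^-n], the function
   [H = sum 4^n |v_n|^2] is integrable, and [|v_n| <= 2^-n sqrt H] pointwise. *)
Lemma L2_fast_cauchy_cvg : fast_cauchy_cvg (L2 mu).
Proof.
move=> u uC; pose f n := repr (u n) : T -> R[i].
pose h n x : \bar R := (4 ^+ n * normsq (f n.+1 x - f n x))%:E.
pose H x := (\sum_(n <oo) h n x)%E.
have mRe n : measurable_fun setT (@complex.Re R \o f n).
  by have [] := L2fun_sq_integrable (repr (u n)).
have mIm n : measurable_fun setT (@complex.Im R \o f n).
  by have [] := L2fun_sq_integrable (repr (u n)).
have mv n : measurable_fun setT (fun x => (normsq (f n.+1 x - f n x))%:E).
  apply: measurable_normsq.
    rewrite (_ : _ \o _ = (@complex.Re R \o f n.+1) \- (@complex.Re R \o f n)).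
      exact: measurable_funB.
    by apply/funext => x /=; case: (f n.+1 x) (f n x) => ? ? [].
  rewrite (_ : _ \o _ = (@complex.Im R \o f n.+1) \- (@complex.Im R \o f n)).
    exact: measurable_funB.
  by apply/funext => x /=; case: (f n.+1 x) (f n x) => ? ? [].
have h0 n x : (0 <= h n x)%E.
  by rewrite lee_fin mulr_ge0 ?normsq_ge0// exprn_ge0.
have mh n : measurable_fun setT (h n).
  apply/measurable_EFinP; apply: measurable_funM => //.
  exact/measurable_EFinP/mv.
have mH : measurable_fun setT H by apply: ge0_emeasurable_sum.
have H0 x : (0 <= H x)%E by apply: nneseries_ge0.
(* The weight turns [16^-n] into [4^-n]; the weaker bound [2^-n] is written in the shape expected by
   [epsilon_trick0]. *)
have ih n : (\int[mu]_x h n x <= (2 / (2 ^ n.+1)%:R)%:E)%E.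
  rewrite /h; under eq_integral do rewrite EFinM.
  rewrite ge0_integralZl//; last by move=> x _; rewrite lee_fin normsq_ge0.
  rewrite -(@rnorm_ae _ _ _ mu (u n.+1 - u n))//; last 2 first.
  - by move=> x; rewrite lee_fin normsq_ge0.
  - apply: (ae_app (reprD (u n.+1) (- u n))).
    have := reprZ (-1) (u n); rewrite scaleN1r => h1; apply: (ae_app h1).
    by apply: aeW => x -> ->; rewrite mulN1r.
  rewrite -EFinM lee_fin.
  have -> : 2 / (2 ^ n.+1)%:R = (2^-1 : R) ^+ n.
    by rewrite exprVn natrX exprS; field; rewrite expf_neq0.
  have -> : (2^-1 : R) ^+ n = 4 ^+ n * (8^-1 ^+ n).
    by rewrite -exprMn; congr (_ ^+ _); field.
  rewrite ler_wpM2l ?exprn_ge0//.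
  apply: (@le_trans _ _ ((4^-1 ^+ n) ^+ 2)).
    by rewrite ler_pXn2r ?nnegrE ?rnorm_ge0// exprn_ge0// invr_ge0.
  rewrite exprAC lerXn2r ?nnegrE//; lra.
have iH : (\int[mu]_x H x <= 2%:E)%E.
  rewrite /H integral_nneseries//.
  apply: le_trans (epsilon_trick0 xpredT (_ : 0 <= 2 :> R)) => //.
  apply: lee_nneseries => // n _; first by move=> _; exact: integral_ge0.
(* Where [H] is infinite, [l] is 0 and the estimate is trivial. Elsewhere the two parts converge
   separately with error [2 * (2^-1 ^+ n * K)], and 8 comes from adding the squares of both
   errors. *)
have : forall x, exists l : R[i], (H x = +oo%E -> l = 0) /\
    forall n, ((normsq (l - f n x))%:E <= (8 * 4^-1 ^+ n)%:E * H x)%E.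
  move=> x; have [Hoo|Hoo] := eqVneq (H x) +oo%E.
    by exists 0; split=> // n; rewrite Hoo gt0_muley ?leey.
  have Hfin : H x \is a fin_num by rewrite ge0_fin_numE// ltey.
  pose K := Num.sqrt (fine (H x)).
  have KH : K ^+ 2 = fine (H x) by rewrite sqr_sqrtr// fine_ge0.
  have vK n : normsq (f n.+1 x - f n x) <= (2^-1 ^+ n * K) ^+ 2.
    rewrite exprMn KH -exprM mulnC exprM.
    have -> : (2^-1 : R) ^+ 2 = 4^-1 by field.
    rewrite exprVn ler_pdivlMl ?exprn_gt0// -lee_fin fineK//.
    have := @nneseries_lim_ge R (h ^~ x) xpredT 0%N n.+1 (fun k _ _ => h0 k x).
    apply: le_trans; rewrite big_nat_recr//= leeDr// sume_ge0//.
  have absv (p q : R) : 0 <= q -> p ^+ 2 <= q ^+ 2 -> `|p| <= q.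
    by move=> q0 pq; rewrite -(@ler_pXn2r _ 2) ?nnegrE// real_normK ?num_real.
  have K0 : 0 <= K by rewrite sqrtr_ge0.
  have qK0 n : 0 <= 2^-1 ^+ n * K by rewrite mulr_ge0// exprn_ge0// invr_ge0.
  have [p pP] : exists l, forall n, `|l - complex.Re (f n x)| <= 2 * (2^-1 ^+ n * K).
    apply: geometric_increments_limit => // n; apply: absv => //.
    apply: le_trans (vK n); rewrite /normsq.
    by case: (f n.+1 x) (f n x) => ? ? [? ?]/=; rewrite lerDl sqr_ge0.
  have [q qP] : exists l, forall n, `|l - complex.Im (f n x)| <= 2 * (2^-1 ^+ n * K).
    apply: geometric_increments_limit => // n; apply: absv => //.
    apply: le_trans (vK n); rewrite /normsq.
    by case: (f n.+1 x) (f n x) => ? ? [? ?]/=; rewrite lerDr sqr_ge0.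
  exists (p +i* q)%C; split; first by move=> E; rewrite E in Hoo.
  move=> n; rewrite -(fineK Hfin) -EFinM lee_fin -KH.
  have -> : 8 * 4^-1 ^+ n * K ^+ 2 =
      (2 * (2^-1 ^+ n * K)) ^+ 2 + (2 * (2^-1 ^+ n * K)) ^+ 2.
    rewrite !exprMn -exprM mulnC exprM.
    by rewrite (_ : (2^-1 : R) ^+ 2 = 4^-1); field.
  have sqle (s t : R) : `|s| <= t -> s ^+ 2 <= t ^+ 2.
    by move=> st; rewrite -(real_normK (num_real s)) lerXn2r ?nnegrE// (le_trans _ st).
  move: (sqle _ _ (pP n)) (sqle _ _ (qP n)); rewrite /normsq.
  by case: (f n x) => ? ? /= ? ?; exact: lerD.
move=> /choice[l lP].
(* Here [c] stands for the real or the imaginary part. The limit is measurable because [f n], cut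
   off to the measurable set where [H] is finite, converges to [l] everywhere. *)
have lcv (c : R[i] -> R) : (forall z w, c (z - w) = c z - c w) ->
    (forall z, c z ^+ 2 <= normsq z) ->
    (forall n, measurable_fun setT (c \o f n)) -> measurable_fun setT (c \o l).
  move=> cB cle mc; pose D := [set x | H x \is a fin_num].
  have mD : measurable D by rewrite -[D]setTI; exact: emeasurable_fin_num.
  apply: (@measurable_fun_cvg _ _ _ _ (fun n x => \1_D x * c (f n x))).
    by move=> n; apply: measurable_funM => //; exact: mc.
  move=> x _; have c0 : c 0 = 0 by rewrite -(subrr (0 : R[i])) cB subrr.
  have [Dx|nDx] := pselect (D x); last first.
    have Hoo : H x = +oo%E.
      by apply/eqP; rewrite -leye_eq leNgt -ge0_fin_numE//; exact/negP.
    rewrite /= (lP x).1// c0; apply: cvg_near_cst; near=> n.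
    by rewrite indicE memNset// mul0r.
  have cvf : (8 * (4^-1 : R) ^+ n * fine (H x)) @[n --> \oo] --> (0 : R).
    rewrite -[X in _ --> X](mul0r (fine (H x))); apply: cvgMl.
    by apply: cvg_geometric; rewrite ger0_norm ?invr_ge0// invf_lt1// ltr1n.
  apply/cvgrPdist_lt => e e0; move/cvgrPdist_lt: cvf => /(_ (e ^+ 2)).
  rewrite exprn_gt0// => /(_ isT); apply: filterS => n.
  rewrite sub0r normrN indicE mem_set// mul1r -cB => le2.
  rewrite -[(_ < _)%R]/(`|c (l x - f n x)| < e).
  rewrite -(@ltr_pXn2r _ 2) ?nnegrE ?(ltW e0)// real_normK ?num_real//.
  apply: le_lt_trans (cle _) _; apply: le_lt_trans le2.
  apply: le_trans (ler_norm _); rewrite -lee_fin EFinM fineK//.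
  exact: (lP x).2.
have [mlr mli] : measurable_fun setT (@complex.Re R \o l) /\
    measurable_fun setT (@complex.Im R \o l).
  split; apply: lcv => //.
  - by move=> [? ?] [? ?].
  - by move=> [? ?]; rewrite /normsq/= lerDl sqr_ge0.
  - by move=> [? ?] [? ?].
  - by move=> [? ?]; rewrite /normsq/= lerDr sqr_ge0.
have mH8 n : measurable_fun setT (fun x => (8 * 4^-1 ^+ n)%:E * H x)%E.
  exact: measurable_funeM.
have c80 n : 0 <= 8 * (4^-1 : R) ^+ n.
  by rewrite mulr_ge0// exprn_ge0// invr_ge0.
have int8 n : (\int[mu]_x ((8 * 4^-1 ^+ n)%:E * H x) <= (16 * 4^-1 ^+ n)%:E)%E.
  rewrite ge0_integralZl//.
  apply: le_trans (lee_wpmul2l _ iH) _; first by rewrite lee_fin.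
  by rewrite -EFinM lee_fin mulrAC -natrM.
(* Compare [l] with the square integrable [f 0]. *)
have intl : (\int[mu]_x (normsq (l x))%:E < +oo)%E.
  pose F x := ((2%:E * ((8 * 4^-1 ^+ 0)%:E * H x)) + 2%:E * (normsq (f 0%N x))%:E)%E.
  have mf0 : measurable_fun setT (fun x => (normsq (f 0%N x))%:E).
    exact: measurable_normsq_L2fun.
  apply: (@le_lt_trans _ _ (\int[mu]_x F x)%E).
    apply: ge0_le_integral => //.
    - by move=> x _; rewrite lee_fin normsq_ge0.
    - exact: measurable_normsq.
    - by apply: emeasurable_funD; exact: measurable_funeM.
    - move=> x _; apply: (@le_trans _ _ (2%:E * (normsq (l x - f 0%N x))%:E
          + 2%:E * (normsq (f 0%N x))%:E)%E).
        by rewrite -!EFinM -EFinD lee_fin -{1}(subrK (f 0%N x) (l x)) normsqD_le.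
      by apply: leeD => //; apply: lee_wpmul2l; [rewrite lee_fin|exact: (lP x).2].
  have H80 x : (0 <= (8 * 4^-1 ^+ 0)%:E * H x)%E by rewrite mule_ge0// lee_fin.
  have f00 x : (0 <= (normsq (f 0%N x))%:E)%E by rewrite lee_fin normsq_ge0.
  rewrite ge0_integralD//; last 4 first.
  - by move=> x _; rewrite mule_ge0// lee_fin.
  - exact: measurable_funeM.
  - by move=> x _; rewrite mule_ge0// lee_fin.
  - exact: measurable_funeM.
  rewrite (ge0_integralZl _ measurableT (mH8 0%N))//.
  rewrite (ge0_integralZl _ measurableT mf0)//.
  rewrite lte_add_pinfty// lte_mul_pinfty// ?lee_fin//.
    by rewrite (le_lt_trans (int8 0%N))// ltry.
  by rewrite -[X in (X < _)%E](rnorm_repr (u 0%N)) ltry.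
have L2l : l \in L2fun_pred mu by apply/asboolP; exact: sq_integrable_normsq.
exists (\pi_(L2 mu) (MkL2fun L2l))%qT.
set L := (\pi_(L2 mu) _)%qT.
have Lu n : rnorm (L - u n) ^+ 2 <= 16 * 4^-1 ^+ n.
  have mln : measurable_fun setT (fun x => (normsq (l x - f n x))%:E).
    apply: measurable_normsq.
      rewrite (_ : _ \o _ = (@complex.Re R \o l) \- (@complex.Re R \o f n)).
        exact: measurable_funB.
      by apply/funext => x /=; case: (l x) (f n x) => ? ? [].
    rewrite (_ : _ \o _ = (@complex.Im R \o l) \- (@complex.Im R \o f n)).
      exact: measurable_funB.
    by apply/funext => x /=; case: (l x) (f n x) => ? ? [].
  rewrite -lee_fin (rnorm_ae mln); last 2 first.
  - by move=> x; rewrite lee_fin normsq_ge0.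
  - apply: (ae_app (reprD L (- u n))).
    have := reprZ (-1) (u n); rewrite scaleN1r => h1; apply: (ae_app h1).
    apply: (ae_app (L2_reprP (MkL2fun L2l))).
    by apply: aeW => x -> -> ->; rewrite mulN1r.
  apply: le_trans (int8 n); apply: ge0_le_integral => //.
  - by move=> x _; rewrite lee_fin normsq_ge0.
  - by move=> x _; exact: (lP x).2.
move=> e e0.
have : (fun n => 16 * (4^-1 : R) ^+ n) @ \oo --> (0 : R).
  by apply: cvg_geometric; rewrite ger0_norm ?invr_ge0// invf_lt1// ltr1n.
move=> /cvgrPdist_lt/(_ (e ^+ 2)); rewrite exprn_gt0// => /(_ isT).
apply: filterS => n; rewrite sub0r normrN ger0_norm; last first.
  by rewrite mulr_ge0// exprn_ge0// invr_ge0.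
by move=> /(le_lt_trans (Lu n)); rewrite ltr_pXn2r ?nnegrE ?rnorm_ge0 ?ltW.
Unshelve. all: by end_near. Qed.

End Completeness.

(** * Cutting the real line into small cells *)

Section Quantizer.
Context (R : realType).
Implicit Types (A : seq R) (t a : R).

(** Each [a] counts once at [a] and once more beyond it, so the nonempty level sets are the points
    of [A] and the open intervals that they cut out. *)
Fixpoint cut_count A t : nat :=
  if A is a :: A' then (((a <= t)%R + (a < t)%R)%N + cut_count A' t)%N else 0%N.

Lemma cut_count_le_size A t : (cut_count A t <= (size A).*2)%N.
Proof.
elim: A => //= a A IHA; rewrite doubleS -add2n leq_add//.
by case: (a <= t)%R (a < t)%R => [] [].
Qed.

Lemma cut_count_homo A : {homo cut_count A : t u / t <= u >-> (t <= u)%N}.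
Proof.
move=> t u tu; elim: A => //= a A IHA; rewrite !leq_add//.
  by case: (boolP (a <= t)%R) => // /le_trans/(_ tu) ->.
by case: (boolP (a < t)%R) => // /lt_le_trans/(_ tu) ->.
Qed.

(** Every summand is monotone, so equal sums force equal summands. *)
Lemma cut_count_eq A t u a : cut_count A t = cut_count A u -> a \in A ->
  (a <= t)%R = (a <= u)%R /\ (a < t)%R = (a < u)%R.
Proof.
wlog tu : t u / t <= u => [hw|].
  have [tu|/ltW ut] := leP t u; first exact: hw.
  by move=> /esym/(hw _ _ ut) h /h[-> ->].
elim: A => //= b A IHA E.
have hA := cut_count_homo A tu.
have h1 : ((b <= t)%R <= (b <= u)%R)%N.
  by case: (boolP (b <= t)%R) => // /le_trans/(_ tu) ->.
have h2 : ((b < t)%R <= (b < u)%R)%N.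
  by case: (boolP (b < t)%R) => // /lt_le_trans/(_ tu) ->.
have [E1 E2 E3] : [/\ nat_of_bool (b <= t)%R = (b <= u)%R,
    nat_of_bool (b < t)%R = (b < u)%R & cut_count A t = cut_count A u].
  move: (cut_count A t) (cut_count A u) hA E h1 h2 => m n.
  case: (b <= t)%R (b <= u)%R (b < t)%R (b < u)%R => [] [] [] [] /= hA E h1 h2;
    by split; move: hA E h1 h2; rewrite /=; lia.
rewrite inE => /orP[/eqP ->|]; last exact: IHA.
split.
  by move: E1; do 2 case: (_ <= _)%R.
by move: E2; do 2 case: (_ < _)%R.
Qed.

End Quantizer.

Section SmallCells.
Context d (Y : measurableType d) (R : realType).
Variable nu : {measure set Y -> \bar R}.
Variable g : {mfun Y >-> R}.

Lemma rnorm_chi_subset (A B : set Y) (u : L2 nu) : measurable A -> measurable B ->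
  A `<=` B -> rnorm (chi_mul A u) <= rnorm (chi_mul B u).
Proof.
move=> mA mB AB; rewrite -(setIidl AB) -chi_mulI//.
by rewrite (le_trans (rnorm_chi_le _ mA))// mul1r.
Qed.

Lemma measurable_mfun_preimage (B : set R) : measurable B -> measurable (g @^-1` B).
Proof. by move=> mB; rewrite -[_ @^-1` _]setTI; exact: measurable_funPT. Qed.

(** In the application [s] is a finite net of the image of the unit ball under a compact operator,
    so smallness on [s] bounds the operator cut to [B]. *)
Definition small (s : seq (L2 nu)) (e : R) (B : set R) :=
  forall u, u \in s -> rnorm (chi_mul (g @^-1` B) u) < e.

Lemma small_eventually s e (B : nat -> set R) : 0 < e -> (forall n, measurable (B n)) ->
  (forall t, \forall n \near \oo, ~ B n t) -> \forall n \near \oo, small s e (B n).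
Proof.
move=> e0 mB B0; elim: s => [|v s IHs]; first by near=> n.
have : \forall n \near \oo, rnorm (chi_mul (g @^-1` B n) v) < e.
  apply: chi_mul_cvg0 => // [n|y]; last exact: B0.
  exact: measurable_mfun_preimage.
apply: filterS2 IHs => n sn vn u; rewrite inE => /orP[/eqP ->//|]; exact: sn.
Unshelve. all: by end_near. Qed.

(** One-sided intervals without [t] shrink to the empty set; with [t] included this would fail when
    the level set of [g] at [t] has positive measure. *)
Lemma small_near s e t : 0 < e -> exists2 r : R, 0 < r &
  (small s e `]t, (t + r)[) /\ (small s e `](t - r), t[).
Proof.
move=> e0.
have inv0 (c : R) : 0 < c -> \forall n \near \oo, (n.+1%:R^-1 : R) < c.
  by move=> c0; apply: (near_infty_natSinv_lt (PosNum c0)).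
have h1 : \forall n \near \oo, small s e `]t, (t + n.+1%:R^-1)[.
  apply: small_eventually => // u; have [ut|tu] := leP u t.
    by near=> n; rewrite /= in_itv/= ltNge ut.
  have := inv0 (u - t); rewrite subr_gt0 => /(_ tu); apply: filterS => n nu'.
  by rewrite /= in_itv/= => /andP[_]; move: nu'; move: n.+1%:R^-1 => c; lra.
have h2 : \forall n \near \oo, small s e `](t - n.+1%:R^-1), t[.
  apply: small_eventually => // u; have [tu|ut] := leP t u.
    by near=> n; rewrite /= in_itv/= [u < t]ltNge tu andbF.
  have := inv0 (t - u); rewrite subr_gt0 => /(_ ut); apply: filterS => n nu'.
  by rewrite /= in_itv/= => /andP[+ _]; move: nu'; move: n.+1%:R^-1 => c; lra.
have [n [n1 n2]] := filter_ex (filterI h1 h2).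
by exists n.+1%:R^-1; rewrite ?invr_gt0.
Unshelve. all: by end_near. Qed.

Lemma small_infty s e : 0 < e -> exists M : R,
  (small s e `]M, +oo[) /\ (small s e `]-oo, (- M)[).
Proof.
move=> e0.
have big (c : R) : \forall n \near \oo, c < n%:R by exact: nbhs_infty_gtr.
have h1 : \forall n \near \oo, small s e `]n%:R, +oo[.
  apply: small_eventually => // u; apply: filterS (big u) => n un.
  by rewrite /= in_itv/= andbT; lra.
have h2 : \forall n \near \oo, small s e `]-oo, (- n%:R)[.
  apply: small_eventually => // u; apply: filterS (big (- u)) => n un.
  by rewrite /= in_itv/=; lra.
have [n [n1 n2]] := filter_ex (filterI h1 h2).
by exists n%:R.
Qed.

(* Cells are the level sets of [cut_count A], where [A] consists of the centres
   and endpoints of a finite cover of [[-M, M]] by intervals [small] on either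
   side of their centre; a cell meeting [A] is a point, and any other cell lies
   in one of the half intervals. *)
Lemma small_cells s e : 0 < e -> exists N (q : R -> 'I_N),
  {homo q : t u / t <= u >-> (t <= u)%N} /\
  forall k, (exists a, forall t, q t = k -> t = a) \/ small s e (q @^-1` [set k]).
Proof.
move=> e0; have [M [Mp Mn]] := small_infty s e0.
have /choice[r rP] : forall t, exists r : R, 0 < r /\
    ((small s e `]t, (t + r)[) /\ (small s e `](t - r), t[)).
  by move=> t; have [r] := small_near s t e0; exists r.
have cM : cover_compact (`[- M, M] : set R).
  by rewrite -compact_cover; exact: segment_compact.
have [|t _|D _ MD] := cM R setT (fun t => ball t (r t)).
- by move=> t _; apply: ball_open; case: (rP t).
- by exists t => //; apply: ballxx; case: (rP t).
pose D' : seq R := finmap.enum_fset D.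
(* The points [- M] and [M] separate the outer rays, small by the choice of [M], from the covered
   segment. *)
pose A := [:: - M; M] ++ (D' ++ ([seq t - r t | t <- D'] ++ [seq t + r t | t <- D'])).
(* Counts run from 0 to twice the size of [A], so [inord] never takes its default value. *)
exists (size A).*2.+1, (fun t => inord (cut_count A t)).
have qE t : (inord (cut_count A t) : 'I_(size A).*2.+1) = cut_count A t :> nat.
  by rewrite inordK// ltnS cut_count_le_size.
split; first by move=> t u tu; rewrite !qE cut_count_homo.
(* An empty cell passes vacuously for a point. *)
move=> k; have [[t0 t0k]|nk] := pselect (exists t, inord (cut_count A t) = k); last first.
  by left; exists 0 => t tk; exfalso; apply: nk; exists t.
have kA t a : inord (cut_count A t) = k -> a \in A ->
    (a <= t)%R = (a <= t0)%R /\ (a < t)%R = (a < t0)%R.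
  move=> tk; apply: cut_count_eq.
  by have := congr1 val (etrans tk (esym t0k)); rewrite /= !qE.
have sub (B : set R) : measurable B -> small s e B ->
    (forall t, inord (cut_count A t) = k -> B t) ->
    small s e ((fun t => inord (cut_count A t)) @^-1` [set k]).
  move=> mB sB kB u us; apply: le_lt_trans (sB u us); apply: rnorm_chi_subset.
  (* A level set of a monotone map is an interval, hence Borel. *)
  - apply: measurable_mfun_preimage; apply: is_interval_measurable.
    move=> x y /= xk yk z /andP[xz zy]; apply/val_inj/eqP.
    rewrite /= qE eqn_leq -{1}yk -xk !qE !cut_count_homo//.
  - exact: measurable_mfun_preimage.
  - by move=> y /= /kB.
have [t0A|t0A] := boolP (t0 \in A).
  left; exists t0 => t tk; have [] := kA _ _ tk t0A; rewrite lexx ltxx => h1 h2.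
  by apply/eqP; rewrite eq_le h1 andbT leNgt h2.
right.
have [t0M|Mt0] := ltP t0 (- M).
  apply: (sub [set` `]-oo, (- M)[]) => // t tk; rewrite /= in_itv/=.
  have [h _] := kA t (- M) tk ltac:(by rewrite !inE eqxx).
  by rewrite ltNge h -ltNge.
have [t0M|t0M] := ltP M t0.
  apply: (sub [set` `]M, +oo[]) => // t tk; rewrite /= in_itv/= andbT.
  by have [_ ->] := kA t M tk ltac:(by rewrite !inE eqxx orbT).
have [|t1 t1D] := MD t0; first by rewrite /= in_itv/= Mt0.
rewrite /ball/= ltr_norml ltrBlDr => /andP[ht1 ht2].
have t1D' : t1 \in D' by [].
have t1A : t1 \in A by rewrite !mem_cat t1D' orbT.
have t1lA : t1 - r t1 \in A by rewrite !mem_cat (map_f (fun t => t - r t)) ?orbT.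
have t1rA : t1 + r t1 \in A by rewrite !mem_cat (map_f (fun t => t + r t)) ?orbT.
have [_ [sr sl]] := rP t1.
have [t10|t01|t01] := ltgtP t1 t0; last by rewrite -t01 t1A in t0A.
  apply: (sub [set` `]t1, (t1 + r t1)[]) => // t tk; rewrite /= in_itv/=.
  have [_ ->] := kA t _ tk t1A; have [h _] := kA t _ tk t1rA.
  by rewrite t10/= ltNge h -ltNge; lra.
apply: (sub [set` `](t1 - r t1), t1[]) => // t tk; rewrite /= in_itv/=.
have [_ ->] := kA t _ tk t1lA; have [h _] := kA t _ tk t1A.
rewrite [t < t1]ltNge h -ltNge t01 andbT; lra.
Qed.

End SmallCells.

(** * Synthesis for sets of finite width *)

Section Synthesis.
Context d1 d2 (X : measurableType d1) (Y : measurableType d2) (R : realType).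
Variables (mu : {measure set X -> \bar R}) (nu : {measure set Y -> \bar R}).
Implicit Types (E : set (X * Y)) (T : bounded_op (L2 mu) (L2 nu)).
Implicit Types (A : set X) (B : set Y).

Lemma marginally_null_subset E1 E2 : E1 `<=` E2 ->
  marginally_null mu nu E2 -> marginally_null mu nu E1.
Proof.
by move=> E12 [X0 [Y0 [? ? ? ? E2n]]]; exists X0, Y0; split=> // p /E12/E2n.
Qed.

Lemma marginally_null0 E : E `<=` set0 -> marginally_null mu nu E.
Proof.
move=> E0; exists set0, set0; split=> //; try exact: measure0.
by move=> p /E0.
Qed.

Lemma MmaxP E T : Mmax mu nu E T <-> forall A B, measurable A -> measurable B ->
  marginally_null mu nu ((A `*` B) `&` E) ->
  forall x, chi_mul B (T (chi_mul A x)) = 0.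
Proof.
split=> TE A B mA mB AB; last by apply/funext => x; exact: TE.
by move=> x; have /(congr1 (@^~ x)) := TE A B mA mB AB.
Qed.

Lemma MmaxT T : Mmax mu nu setT T.
Proof.
apply/MmaxP => A B mA mB; rewrite setIT => -[X0 [Y0 [mX mY X00 Y00 AB]]] x.
have [AX|/existsNP[a /not_implyP[Aa aX]]] := pselect (A `<=` X0).
  rewrite (chi_mul_null x mA); last exact: subset_measure0 X00.
  by rewrite linear0 -[chi_mul B _]/(chi_op mB _) linear0.
have BY : B `<=` Y0 by move=> b Bb; have [] := AB (a, b) (conj Aa Bb) => -[].
by apply: chi_mul_null => //; exact: subset_measure0 Y00.
Qed.

Lemma Mmax0 E : Mmax mu nu E 0.
Proof. by apply/MmaxP => A B mA mB _ x; exact: (linear0 (chi_op mB)). Qed.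

Lemma MmaxD E S T : Mmax mu nu E S -> Mmax mu nu E T -> Mmax mu nu E (S + T).
Proof.
move=> /MmaxP SE /MmaxP TE; apply/MmaxP => A B mA mB AB x.
by rewrite addopE -[chi_mul B _]/(chi_op mB _) linearD/= SE// TE// addr0.
Qed.

Lemma MmaxZ E c T : Mmax mu nu E T -> Mmax mu nu E (c *: T).
Proof.
move=> /MmaxP TE; apply/MmaxP => A B mA mB AB x.
by rewrite scaleopE -[chi_mul B _]/(chi_op mB _) linearZ/= TE// scaler0.
Qed.

Lemma Mmax_closed E : closure (Mmax mu nu E) `<=` Mmax mu nu E.
Proof.
move=> T /closure_rnorm clT; apply/MmaxP => A B mA mB AB x.
apply: rnorm_eq0; apply/eqP; rewrite eq_le rnorm_ge0 andbT.
have x1 : 0 < rnorm x + 1 by rewrite ltr_wpDl ?rnorm_ge0.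
apply/ler_addgt0Pr => e e0; rewrite add0r.
have [|S /MmaxP SE TS] := clT (e / (rnorm x + 1)); first by rewrite divr_gt0.
have -> : chi_mul B (T (chi_mul A x)) = chi_op mB ((T - S) (chi_op mA x)).
  by rewrite subopE linearB/= SE// subr0.
apply: le_trans (rnorm_chi_le _ mB) _; rewrite mul1r.
apply: le_trans (rnorm_op_ub _ _) _.
have Ax := rnorm_chi_le x mA; rewrite mul1r in Ax.
move: TS; rewrite ltr_pdivlMr// => /ltW; apply: le_trans.
by rewrite ler_wpM2l ?rnorm_ge0//= (le_trans Ax)// lerDl.
Qed.

Definition block A B (mA : measurable A) (mB : measurable B) T :=
  comp_op (chi_op mB) (comp_op T (chi_op mA)).

Lemma tb_block A B (mA : measurable A) (mB : measurable B) T :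
  tb_op T -> tb_op (block mA mB T).
Proof.
by move=> tT; apply/tb_op_comp/tb_op_precomp => //; exact: rnorm_chi_op.
Qed.

Lemma rank_le1_block A B (mA : measurable A) (mB : measurable B) T :
  rank_le1 T -> rank_le1 (block mA mB T).
Proof.
move=> [y Ty]; exists (chi_op mB y) => x; have [c Tc] := Ty (chi_op mA x).
by exists c; rewrite /block/= Tc -[chi_mul B _]/(chi_op mB _) linearZ.
Qed.

Lemma rnorm_block A B (mA : measurable A) (mB : measurable B) T :
  rnorm (block mA mB T) <= rnorm T.
Proof.
apply: le_trans (rnorm_comp_op _ _) _.
apply: le_trans (ler_wpM2l (rnorm_ge0 _) (rnorm_comp_op _ _)) _.
rewrite -[leRHS]mul1r ler_pM ?mulr_ge0 ?rnorm_ge0 ?rnorm_chi_op//.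
by rewrite ler_piMr ?rnorm_ge0 ?rnorm_chi_op.
Qed.

Lemma block_idem A B (mA : measurable A) (mB : measurable B) T :
  block mA mB (block mA mB T) = block mA mB T.
Proof. by apply: op_ext => x; rewrite /= !chi_mulI// !setIid. Qed.

Lemma block_linear A B (mA : measurable A) (mB : measurable B) :
  linear (block mA mB).
Proof.
move=> c S T; apply: op_ext => x.
rewrite -[LHS]/(chi_op mB (c *: S (chi_op mA x) + T (chi_op mA x))).
by rewrite linearP.
Qed.

Lemma Mmax_block E1 E2 A B (mA : measurable A) (mB : measurable B) T :
  (A `*` B) `&` E1 `<=` E2 ->
  Mmax mu nu E1 T -> Mmax mu nu E2 (block mA mB T).
Proof.
move=> AB12 /MmaxP TE; apply/MmaxP => A' B' mA' mB' AB' x; rewrite /= !chi_mulI//.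
apply: TE; [exact: measurableI|exact: measurableI|].
apply: marginally_null_subset AB' => p /= [[[Ap A'p] [B'p Bp]] E1p].
by split; [split|exact: AB12].
Qed.

Definition synthetic E := forall T, Mmax mu nu E T -> tb_op T ->
  closure (lin_span (Mmax mu nu E `&` rank_one_ops (L2 mu) (L2 nu))) T.

Lemma syntheticT : synthetic setT.
Proof.
move=> T _ /tb_op_finite_rank_approx.
rewrite (_ : _ `&` _ = rank_one_ops (L2 mu) (L2 nu))//.
by apply/seteqP; split=> [S []//|S S1]; split=> //; exact: MmaxT.
Qed.

Lemma closure_span_block E1 E2 A B (mA : measurable A) (mB : measurable B) T :
  synthetic E1 -> E2 `<=` E1 -> (A `*` B) `&` E1 `<=` E2 ->
  Mmax mu nu E2 T -> tb_op T ->
  closure (lin_span (Mmax mu nu E2 `&` rank_one_ops (L2 mu) (L2 nu))) (block mA mB T).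
Proof.
move=> sE1 E21 AB12 TE tT; apply/closure_rnorm => e e0.
have TE1 : Mmax mu nu E1 (block mA mB T) by apply: Mmax_block TE => p [_ /E21].
have /closure_rnorm/(_ e e0)[S Sspan TS] := sE1 _ TE1 (tb_block mA mB tT).
exists (block mA mB S); last first.
  have bl := block_linear mA mB.
  have -> : block mA mB T - block mA mB S = block mA mB (block mA mB T - S).
    by rewrite [in RHS]addrC -[- S]scaleN1r bl block_idem scaleN1r addrC.
  exact: le_lt_trans (rnorm_block _ _ _) TS.
pose spanned S' := lin_span (Mmax mu nu E2 `&` rank_one_ops (L2 mu) (L2 nu))
  (block mA mB S').
have sub : lin_span (Mmax mu nu E1 `&` rank_one_ops (L2 mu) (L2 nu)) `<=` spanned.
  apply: lin_span_subset; rewrite /spanned.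
  - rewrite (_ : block _ _ 0 = 0); first exact: lin_span0.
    by apply: op_ext => x /=; exact: (linear0 (chi_op mB)).
  - move=> S1 S2 h1 h2; rewrite (_ : block _ _ (S1 + S2) = block mA mB S1 + block mA mB S2).
      exact: lin_spanD.
    by have := block_linear mA mB 1 S1 S2; rewrite !scale1r.
  - move=> c S1 h1; rewrite (_ : block _ _ (c *: S1) = c *: block mA mB S1).
      exact: lin_spanZ.
    apply: op_ext => x; rewrite -[LHS]/(chi_op mB (c *: S1 (chi_op mA x))).
    by rewrite linearZ.
  - move=> S1 [S1E S1r].
    have [->|br] := rank_le1_rank_one (rank_le1_block mA mB (rank_one_le1 S1r)).
      exact: lin_span0.
    by apply: subset_lin_span; split=> //; exact: Mmax_block S1E.
exact: sub.
Qed.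

Section Truncation.
Variables (N : nat) (p : X -> 'I_N) (q : Y -> 'I_N).
Hypothesis mp : forall k, measurable (p @^-1` [set k]).
Hypothesis mq : forall k, measurable (q @^-1` [set k]).

Let cell (j k : 'I_N) T := block (mp j) (mq k) T.

Lemma sum_cells T : T = \sum_k \sum_j cell j k T.
Proof.
apply: op_ext => x; rewrite {1}(chi_partition mq (T x)) sumopE; apply: eq_bigr => k _.
rewrite sumopE {1}(chi_partition mp x) linear_sum.
by rewrite -[chi_mul _ _]/(chi_op (mq k) _) linear_sum.
Qed.

Lemma rnorm_diag_cells T (P : pred 'I_N) (c : R) : 0 <= c ->
  (forall k x, P k -> rnorm (chi_mul (q @^-1` [set k]) (T x)) <= c * rnorm x) ->
  rnorm (\sum_(k | P k) cell k k T) <= c.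
Proof.
move=> c0 Pc; apply: rnorm_op_le => x x1; apply: le_trans (_ : c * rnorm x <= _).
  rewrite -(@ler_pXn2r _ 2) ?nnegrE ?mulr_ge0 ?rnorm_ge0//.
  rewrite exprMn (rnorm_partition mp x) (rnorm_partition mq (_ x)) mulr_sumr.
  apply: ler_sum => k _; rewrite -exprMn lerXn2r ?nnegrE ?mulr_ge0 ?rnorm_ge0//.
  rewrite sumopE -[chi_mul _ _]/(chi_op (mq k) _) linear_sum/=.
  have off j : P j -> j != k ->
      chi_mul (q @^-1` [set k]) (cell j j T x) = 0.
    move=> _ jk; rewrite /= chi_mulI// chi_mul_null//; first exact: measurableI.
    rewrite (_ : _ `&` _ = set0) ?measure0//.
    by apply/seteqP; split=> // y [/= -> kj]; rewrite kj eqxx in jk.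
  have [Pk|nPk] := boolP (P k); last first.
    rewrite big1 ?rnorm0 ?mulr_ge0 ?rnorm_ge0// => j Pj; apply: off => //.
    by apply: contraNneq nPk => <-.
  rewrite (bigD1 k)//= big1 ?addr0 => [|j /andP[Pj jk]]; last exact: off.
  by rewrite chi_mulI// setIid; exact: Pc.
by rewrite ler_piMr.
Qed.

End Truncation.

Lemma synthetic_halfspace E (f : {mfun X >-> R}) (g : {mfun Y >-> R}) :
  synthetic E -> synthetic (E `&` [set p | f p.1 <= g p.2]).
Proof.
set E2 := E `&` _ => sE T TE tT.
apply: closed_closure => /=; apply/closure_rnorm => e e0.
have e4 : 0 < e / 4 by rewrite divr_gt0.
have [s sT] := (tb_opP T).1 tT _ e4.
have [N [q [qhomo qsmall]]] := small_cells g s e4.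
have mq0 k : measurable (q @^-1` [set k]).
  apply: is_interval_measurable => x y /= xk yk z /andP[xz zy].
  by apply/val_inj/eqP; rewrite /= eqn_leq -{1}yk -xk !qhomo.
have mp k : measurable ((q \o f) @^-1` [set k]).
  exact: (measurable_mfun_preimage f (mq0 k)).
have mq k : measurable ((q \o g) @^-1` [set k]).
  exact: (measurable_mfun_preimage g (mq0 k)).
pose good k := `[< small g s (e / 4) (q @^-1` [set k]) >].
pose S := \sum_k \sum_(j | ~~ ((j == k) && good k)) block (mp j) (mq k) T.
exists S.
  apply: closure_lin_span_sum => k _; apply: closure_lin_span_sum => j jk.
  have [kj|jk'] := ltnP k j.
    rewrite (_ : block _ _ T = 0); first exact: closure_lin_span0.
    move/MmaxP : TE => TE; apply: op_ext => x; apply: TE => //.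
    apply: marginally_null0 => -[a b] /= [[qa qb] [_ /= fg]].
    by have := qhomo _ _ fg; rewrite qa qb leqNgt kj.
  apply: (closure_span_block sE) => //; first by move=> ? [].
  move=> [a b] /= [[qa qb] Eab]; split=> //=.
  have [jk2|] := eqVneq j k.
    move: jk; rewrite jk2 eqxx/= => /asboolPn ngood.
    have [[t tP]|//] := qsmall k.
    have fa : f a = t by apply: tP; rewrite qa.
    have gb : g b = t by apply: tP.
    by rewrite fa gb.
  rewrite leNgt; apply: contra_neqN => /ltW/qhomo; rewrite qa qb => kj.
  by apply/val_inj/eqP; rewrite eqn_leq jk' kj.
have -> : T - S = \sum_(k | good k) block (mp k) (mq k) T.
  rewrite {1}(sum_cells mp mq T) /S -sumrB [RHS]big_mkcond; apply: eq_bigr => k _.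
  rewrite [X in X - _](bigID (fun j => (j == k) && good k)) /= addrK.
  have [gk|ngk] := boolP (good k).
    by under eq_bigl do rewrite andbT; rewrite big_pred1_eq.
  by rewrite big_pred0// => j; rewrite andbF.
apply: (@le_lt_trans _ _ (e / 4 + e / 4)); last by lra.
apply: rnorm_diag_cells => [|k x /asboolP gk]; first by lra.
have gkT : rnorm (comp_op (chi_op (mq k)) T) <= e / 4 + e / 4.
  apply: rnorm_op_le => z z1; have [y ys Ty] := sT z z1; rewrite /=.
  rewrite -[T z](subrK y) -[chi_mul _ _]/(chi_op (mq k) _) linearD/=.
  apply: le_trans (ler_rnormD _ _) _; apply: lerD; last exact/ltW/gk.
  by apply: le_trans (rnorm_chi_le _ (mq k)) _; rewrite mul1r ltW.
apply: le_trans (rnorm_op_ub (comp_op (chi_op (mq k)) T) x) _.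
by rewrite ler_wpM2r ?rnorm_ge0.
Qed.

End Synthesis.

Section FiniteWidth.
Context d1 d2 (X : measurableType d1) (Y : measurableType d2) (R : realType).
Variables (mu : {measure set X -> \bar R}) (nu : {measure set Y -> \bar R}).

Lemma synthetic_finite_width E : finite_width R E -> synthetic mu nu E.
Proof.
move=> [n]; elim: n E => [|n IHn] E [f [g ->]].
  rewrite (_ : [set _ | _] = setT); first exact: syntheticT.
  by apply/seteqP; split=> // p _ [].
rewrite (_ : [set _ | _] = [set p | forall i : 'I_n, f (lift ord0 i) p.1 <= g (lift ord0 i) p.2]
    `&` [set p | f ord0 p.1 <= g ord0 p.2]).
  apply: synthetic_halfspace; apply: IHn.
  by exists (fun i => f (lift ord0 i)), (fun i => g (lift ord0 i)).
apply/seteqP; split=> p /= => [h|[h h0] i]; first by split.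
by have [j ->|->] := unliftP ord0 i.
Qed.

Lemma finite_width_compact E : finite_width R E ->
  Mmax mu nu E `&` compact_ops (L2 mu) (L2 nu) =
  closure (lin_span (Mmax mu nu E `&` rank_one_ops (L2 mu) (L2 nu))).
Proof.
move=> Efw; have tbE : compact_ops (L2 mu) (L2 nu) = @tb_op R (L2 mu) (L2 nu).
  apply/seteqP; split=> T; first exact: precompact_totally_bounded.
  exact/totally_bounded_precompact/L2_fast_cauchy_cvg.
rewrite tbE; apply/seteqP; split=> [T [TE tT]|T clT].
  exact: synthetic_finite_width.
have span_sub (B : set (bounded_op (L2 mu) (L2 nu))) : B 0 ->
    (forall x y, B x -> B y -> B (x + y)) -> (forall c x, B x -> B (c *: x)) ->
    closure B `<=` B -> Mmax mu nu E `&` rank_one_ops (L2 mu) (L2 nu) `<=` B -> B T.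
  by move=> B0 BD BZ Bcl sB; apply: Bcl; apply: closureS clT; exact: lin_span_subset.
split; apply: span_sub.
- exact: Mmax0.
- exact: MmaxD.
- exact: MmaxZ.
- exact: Mmax_closed.
- by move=> S [].
- exact: tb_op0.
- exact: tb_opD.
- exact: tb_opZ.
- exact: tb_op_closed.
- by move=> S [_ /rank_one_tb].
Qed.

End FiniteWidth.

Theorem theorem5p4 (R : realType) (X Y : completeMetricType R)
    (mu : {measure set (borel X) -> \bar R})
    (nu : {measure set (borel Y) -> \bar R})
    (hmu : standard_measure mu) (hnu : standard_measure nu)
    (E : set (borel X * borel Y)) (hE : finite_width R E) :
  Mmax mu nu E `&` compact_ops (L2 mu) (L2 nu) =
  closure (lin_span (Mmax mu nu E `&` rank_one_ops (L2 mu) (L2 nu))).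
Proof. exact: finite_width_compact. Qed.
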